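(* Let $\Omega$ be open and let $f$ be slice regular on $\Omega$. If $\Omega$ is a slice domain, then exactly one of the following holds: (1) for each $J\in\mathbb{S}_A$, the intersection $V(f)\cap\mathbb{C}_J$ is closed and discrete in $\Omega_J$; (2) $f\equiv0$. If $\Omega$ is a product domain, then, in addition to (1) and (2), there is one further possibility: (3) there exists $J_0\in\mathbb{S}_A$ such that $J=J_0$ satisfies \[f|_{\Omega_J^+}\equiv0\quad\text{and}\quad V(f)\cap\mathbb{C}_{-J}^+\ \text{is closed and discrete in }\Omega_{-J}^+;\tag{$*$}\] the set of $J\in\mathbb{S}_A$ for which $( * )$ holds is determined by the equation $(J-J_0)f'_s\equiv0$; in particular it reduces to $\{J_0\}$ if $f'_s$ takes at least one value that is neither $0$ nor a right zero divisor; and for all other $K\in\mathbb{S}_A$ the intersection $V(f)\cap\mathbb{C}_K^+$ is closed and discrete in $\Omega_K^+$.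
   Context: Let $A$ be a finite-dimensional real algebra with unit $1$ ($\mathbb{R}$ identified with $\mathbb{R}1$) which is alternative (the associator $(x,y,z)=(xy)z-x(yz)$ is alternating), with a $^*$-involution $x\mapsto x^c$ (real linear, $(x^c)^c=x$, $(xy)^c=y^cx^c$, $r^c=r$ for $r\in\mathbb{R}$). Let $t(x)=x+x^c$, $n(x)=xx^c$, $\mathbb{S}_A=\{J\in A:t(J)=0,n(J)=1\}$ (assumed non-empty), $Q_A=\mathbb{R}\cup\{x:t(x),n(x)\in\mathbb{R},4n(x)>t(x)^2\}$; every $x\in Q_A$ is $\alpha+\beta J$ with $\alpha,\beta\in\mathbb{R}$, $J\in\mathbb{S}_A$; $x^c=\alpha-\beta J$, $\mathrm{im}(x)=x-t(x)/2$. For $J\in\mathbb{S}_A$: $\mathbb{C}_J=\mathbb{R}+\mathbb{R}J$, $\mathbb{C}_J^+=\{\alpha+\beta J:\beta>0\}$, $\Omega_J=\Omega\cap\mathbb{C}_J$, $\Omega_J^+=\Omega\cap\mathbb{C}_J^+$. Let $D\subseteq\mathbb{C}$ be open, non-empty, invariant under conjugation, $\Omega=\{\alpha+\beta J:\alpha+i\beta\in D,J\in\mathbb{S}_A\}$. $\Omega$ is a slice domain if $D$ is connected and meets $\mathbb{R}$; a product domain if $D\cap\mathbb{R}=\emptyset$ and $D$ has two connected components exchanged by conjugation. $A_{\mathbb{C}}=\{a+\imath b\}$ with $(a+\imath b)(a'+\imath b')=aa'-bb'+\imath(ab'+ba')$, $\overline{a+\imath b}=a-\imath b$. A stem function $F=F_1+\imath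 F_2:D\to A_{\mathbb{C}}$ satisfies $F(\bar z)=\overline{F(z)}$ and induces $f=\mathcal{I}(F)$, $f(\alpha+\beta J)=F_1(\alpha+i\beta)+JF_2(\alpha+i\beta)$; $f$ is slice regular if $F$ is $\mathscr{C}^1$ and $\frac12\big(\frac{\partial F}{\partial\alpha}+\imath\frac{\partial F}{\partial\beta}\big)\equiv0$. $V(f)=\{x:f(x)=0\}$; $f'_s(x)=\frac12\mathrm{im}(x)^{-1}(f(x)-f(x^c))$ for $x\in\Omega\setminus\mathbb{R}$. A nonzero $a\in A$ is a right zero divisor if $ba=0$ for some nonzero $b\in A$. *)

(* Defs.v *)
From HB Require Import structures.
From mathcomp Require Import all_boot all_order all_algebra.
From mathcomp Require Import all_classical all_reals all_analysis.
Set Implicit Arguments. Unset Strict Implicit. Unset Printing Implicit Defensive.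
Import Order.TTheory GRing.Theory Num.Theory.
Import numFieldNormedType.Exports.
Local Open Scope classical_set_scope.
Local Open Scope ring_scope.

(* A finite-dimensional real algebra is modelled, up to linear isomorphism,
   on the real vector space 'rV[R]_n (with its usual topology), equipped with
   a bilinear product [mul], a unit [one] (R identified with R*one) and a
   *-involution [cj]. *)
Record altstar_alg (R : realType) (n : nat) := AltStarAlg {
  amul : 'rV[R]_n -> 'rV[R]_n -> 'rV[R]_n ;
  aone : 'rV[R]_n ;
  acj  : 'rV[R]_n -> 'rV[R]_n ;
  mul_linl : forall (a : R) x y z, amul (a *: x + y) z = a *: amul x z + amul y z ;
  mul_linr : forall (a : R) x y z, amul z (a *: x + y) = a *: amul z x + amul z y ;
  one_neq0 : aone != 0 ;
  mul1x : forall x, amul aone x = x ;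
  mulx1 : forall x, amul x aone = x ;
  assoc_alt12 : forall x y, amul (amul x x) y - amul x (amul x y) = 0 ;
  assoc_alt13 : forall x y, amul (amul x y) x - amul x (amul y x) = 0 ;
  assoc_alt23 : forall x y, amul (amul y x) x - amul y (amul x x) = 0 ;
  cj_lin : forall (a : R) x y, acj (a *: x + y) = a *: acj x + acj y ;
  cjK : forall x, acj (acj x) = x ;
  cj_mul : forall x y, acj (amul x y) = amul (acj y) (acj x) ;
  cj_real : forall r : R, acj (r *: aone) = r *: aone
}.

Section Defs.
Context {R : realType} {n : nat} (Alg : altstar_alg R n).
Local Notation A := 'rV[R]_n.
Local Notation "x ** y" := (amul Alg x y) (at level 40, left associativity).
Local Notation e := (aone Alg).
Local Notation cj := (acj Alg).

Definition realA : set A := range (fun r : R => r *: e).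

Definition trA (x : A) : A := x + cj x.
Definition nrA (x : A) : A := x ** cj x.

Definition sphA : set A := [set J | trA J = 0 /\ nrA J = e].

(* the real coefficient r of an element r*1 of R*1 *)
Definition realcoef (y : A) : R := (y *m e^T) 0 0 / (e *m e^T) 0 0.

(* inverse of an element y with n(y) real and nonzero: y^{-1} = y^c / n(y) *)
Definition invA (y : A) : A := (realcoef (nrA y))^-1 *: cj y.

Definition imA (x : A) : A := x - 2^-1 *: trA x.

Definition sliceC (J : A) : set A :=
  [set x | exists a b : R, x = a *: e + b *: J].
Definition sliceCp (J : A) : set A :=
  [set x | exists a b : R, 0 < b /\ x = a *: e + b *: J].

(* the circular set Omega associated with D, a subset of C = R x R *)
Definition OmegaD (D : set (R * R)) : set A :=
  [set x | exists (z : R * R) (J : A), D z /\ sphA J /\ x = z.1 *: e + z.2 *: J].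

Definition zeroset (D : set (R * R)) (f : A -> A) : set A :=
  [set x | OmegaD D x /\ f x = 0].

Definition closed_discrete_in (S U : set A) : Prop :=
  (exists C : set A, closed C /\ S = U `&` C) /\
  (forall p, S p -> \forall q \near p, S q -> q = p).

Definition sderA (f : A -> A) (x : A) : A :=
  2^-1 *: (invA (imA x) ** (f x - f (cj x))).

Definition right_zero_divisor (a : A) : Prop :=
  a != 0 /\ exists b : A, b != 0 /\ b ** a = 0.

Definition dalpha (F : R * R -> A) (z : R * R) : A := derive F z (1, 0).
Definition dbeta (F : R * R -> A) (z : R * R) : A := derive F z (0, 1).

Definition C1_on (D : set (R * R)) (F : R * R -> A) : Prop :=
  forall z, D z ->
    [/\ derivable F z (1, 0), derivable F z (0, 1),
        {for z, continuous (dalpha F)} & {for z, continuous (dbeta F)}].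

(* f is slice regular on Omega_D: f = I(F) for a C^1 stem function F = F1 + iF2
   with 1/2 (dF/dalpha + i dF/dbeta) = 0 on D *)
Definition slice_regular (D : set (R * R)) (f : A -> A) : Prop :=
  exists F1 F2 : R * R -> A,
    [/\ (forall a b, D (a, b) -> F1 (a, - b) = F1 (a, b) /\ F2 (a, - b) = - F2 (a, b)),
        C1_on D F1, C1_on D F2,
        (forall z, D z -> dalpha F1 z - dbeta F2 z = 0 /\ dalpha F2 z + dbeta F1 z = 0) &
        (forall z J, D z -> sphA J -> f (z.1 *: e + z.2 *: J) = F1 z + J ** F2 z)].

End Defs.

Definition slice_domain {R : realType} (D : set (R * R)) : Prop :=
  connected D /\ exists a : R, D (a, 0).

Definition product_domain {R : realType} (D : set (R * R)) : Prop :=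
  (forall a : R, ~ D (a, 0)) /\
  exists z1 z2, [/\ D z1, D z2,
    connected_component D z1 != connected_component D z2,
    (forall z, D z -> connected_component D z = connected_component D z1 \/
                      connected_component D z = connected_component D z2) &
    (fun z : R * R => (z.1, - z.2)) @` connected_component D z1
      = connected_component D z2].

Definition exactly_one2 (P Q : Prop) : Prop := (P \/ Q) /\ ~ (P /\ Q).
Definition exactly_one3 (P Q S : Prop) : Prop :=
  (P \/ Q \/ S) /\ ~ (P /\ Q) /\ ~ (P /\ S) /\ ~ (Q /\ S).

(* Main.v *)
Require Import Defs.
From HB Require Import structures.
From mathcomp Require Import all_boot all_order all_algebra.
From mathcomp Require Import all_classical all_reals all_analysis.
From mathcomp Require Import ring lra.
Import Order.TTheory GRing.Theory Num.Theory.
Import numFieldNormedType.Exports.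
From mathcomp Require Import complex.
Set Implicit Arguments. Unset Strict Implicit. Unset Printing Implicit Defensive.
Local Open Scope classical_set_scope.
Local Open Scope ring_scope.

(* A slice regular function restricted to the slice C_J is F1 + J F2, which is
   holomorphic for the complex structure x |-> J x on A: indeed J (J x) = - x by
   alternativity. Its coordinates therefore give pairs (u, v) of C^1 functions
   satisfying the Cauchy-Riemann equations, and the theorem reduces to the
   isolation of the zeros of such a pair on a connected open set: if F1 + J F2
   and F1 - J F2 both vanish then F1 = F2 = 0, while F1 - J F2 at z is F1 + J F2
   at the conjugate of z.

   For the isolation of zeros, write g = u + i v on a disc, rescaled to the unit
   disc. Over the unit circle, int g (w + t (zeta - w)) / (1 - w / zeta) has zero
   derivative in t, hence
     g w * I w = int g zeta / (1 - w / zeta), with I w = int 1 / (1 - w / zeta).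
   Since Re (I w) > 0 for |w| < 1/2, the value of I w is irrelevant: a finite
   geometric expansion of the kernel yields a Taylor formula for g * I with
   uniformly bounded remainders, so that either all coefficients vanish and
   g = 0 near 0, or the first nonzero one keeps g away from 0 off the origin. *)

(** * Real calculus: mean value inequality, differentiability from partials, chain rule along
    paths *)

Lemma is_derive_Ml (R : realType) (f : R -> R) (k s d : R) :
  is_derive s 1 f d -> is_derive s 1 (fun x => k * f x) (k * d).
Proof. by move=> fd; exact: (@is_deriveZ _ _ _ f k s 1 d). Qed.

Lemma mean_value_ineq (R : realType) (f df : R -> R) (a b k : R) :
  (forall x, (a <= x <= b) || (b <= x <= a) ->
     is_derive x 1 f (df x) /\ `|df x| <= k) ->
  `|f b - f a| <= k * `|b - a|.
Proof.
wlog ab : a b / a <= b => [H|] Hf.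
  have [/H|/ltW /H] := leP a b; first exact.
  by rewrite distrC [`|b - a|]distrC; apply => x Hx; apply: Hf; rewrite orbC.
have [||c cab ->] := @MVT_segment _ f df a b ab.
- move=> x; rewrite in_itv/= => /andP[ax xb].
  by have [|] := Hf x; first by rewrite (ltW ax) (ltW xb).
- apply: derivable_within_continuous => x; rewrite in_itv/= => xab.
  have [|dx _] := Hf x; first by rewrite xab.
  exact: ex_derive.
- by rewrite normrM ler_wpM2r//; apply: (Hf _ _).2; rewrite in_itv/= in cab;
  rewrite cab.
Qed.

Lemma is_derive_slice1 (R : realType) (u : R * R -> R) (x y s d : R) :
  is_derive (x + s, y) (1, 0) u d -> is_derive s 1 (fun s => u (x + s, y)) d.
Proof.
have E : (fun h : R => h^-1 *: ((fun s => u (x + s, y)) (h *: 1 + s) - u (x +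
  s, y))) =
  (fun h : R => h^-1 *: (u (h *: (1, 0) + (x + s, y)) - u (x + s, y))).
  apply/funext => h; congr (_ *: (u _ - _)).
  by congr pair; rewrite /= ?scaler0 ?add0r// addrCA.
move=> [du <-]; split; first by rewrite /derivable E.
by rewrite /derive E.
Qed.

Lemma is_derive_slice2 (R : realType) (u : R * R -> R) (x y s d : R) :
  is_derive (x, y + s) (0, 1) u d -> is_derive s 1 (fun s => u (x, y + s)) d.
Proof.
have E : (fun h : R => h^-1 *: ((fun s => u (x, y + s)) (h *: 1 + s) - u (x, y
  + s))) =
  (fun h : R => h^-1 *: (u (h *: (0, 1) + (x, y + s)) - u (x, y + s))).
  apply/funext => h; congr (_ *: (u _ - _)).
  by congr pair; rewrite /= ?scaler0 ?add0r// addrCA.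
move=> [du <-]; split; first by rewrite /derivable E.
by rewrite /derive E.
Qed.

Definition C1_at (R : realType) (u d1 d2 : R * R -> R) (z : R * R) : Prop :=
  [/\ is_derive z (1, 0) u (d1 z), is_derive z (0, 1) u (d2 z),
     {for z, continuous d1} & {for z, continuous d2}].

(** The increment is split into a horizontal leg at height [z.2 + h.2] and a vertical leg at
    abscissa [z.1]. On each leg, u minus its linear part has a derivative of size at most [eps / 2],
    by continuity of the partials, and the mean value inequality applies. *)
Lemma diff_of_partials (R : realType) (u d1 d2 : R * R -> R) (z : R * R) :
  (\forall w \near z, C1_at u d1 d2 w) ->
  is_diff z u (fun w : R * R => d1 z * w.1 + d2 z * w.2).
Proof.
move=> Hd; have [_ _ c1 c2] := nbhs_singleton Hd.
pose L (w : R * R) : R^o := d1 z * w.1 + d2 z * w.2.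
have L_lin : linear L.
  by move=> k v w; rewrite /L/= /GRing.scale/=; ring.
pose L' : {linear (R * R)%type -> R^o} := HB.pack L (GRing.isLinear.Build _ _ _
  _ _ L_lin).
have L_cont : continuous L'.
  by move=> w; apply: cvgD; apply: cvgM; [exact: cvg_cst|exact: cvg_fst|exact:
    cvg_cst|exact: cvg_snd].
suff E : u \o shift z = cst (u z) + L' +o_ (0 : (R * R)%type) id.
  have dE := diff_unique L_cont E.
  by split; [apply/diff_locallyP; rewrite dE | rewrite dE].
apply/eqaddoP => eps eps0.
have e2 : 0 < eps / 2 by rewrite divr_gt0.
have K1 : \forall w \near z, `|d1 z - d1 w| <= eps / 2.
  by move/cvgrPdist_le : c1; exact.
have K2 : \forall w \near z, `|d2 z - d2 w| <= eps / 2.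
  by move/cvgrPdist_le : c2; exact.
have [d /= d0 Bd] : nbhs_ball z [set w | C1_at u d1 d2 w /\
    (`|d1 z - d1 w| <= eps / 2 /\ `|d2 z - d2 w| <= eps / 2)].
  by apply/nbhs_ballP; apply: filterI => //; exact: filterI.
have {}Bd a b : `|a| < d -> `|b| < d ->
  [/\ is_derive (z.1 + a, z.2 + b) (1, 0) u (d1 (z.1 + a, z.2 + b)),
    is_derive (z.1 + a, z.2 + b) (0, 1) u (d2 (z.1 + a, z.2 + b)),
    `|d1 (z.1 + a, z.2 + b) - d1 z| <= eps / 2 &
    `|d2 (z.1 + a, z.2 + b) - d2 z| <= eps / 2].
  move=> ad bd; have [|[? ? _ _] [? ?]] := Bd (z.1 + a, z.2 + b).
    by split; rewrite /ball/= opprD addNKr normrN.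
  by split; rewrite // distrC.
apply/nbhs_ballP; exists d => //= h [].
rewrite /ball/= !sub0r !normrN => h1d h2d.
have -> : (u \o shift z - (cst (u z) + L')) h =
  (u (z.1 + h.1, z.2 + h.2) - d1 z * h.1 - (u (z.1 + 0, z.2 + h.2) - d1 z * 0))
   + (u (z.1, z.2 + h.2) - d2 z * h.2 - (u (z.1, z.2 + 0) - d2 z * 0)).
  rewrite /= /L !fctE /= !addr0 -surjective_pairing.
  rewrite (_ : h + z = (z.1 + h.1, z.2 + h.2)); first by rewrite /=; ring.
  by rewrite -[RHS]/((z.1, z.2) + (h.1, h.2)) -!surjective_pairing addrC.
have lin (k s : R) : is_derive s 1 (fun s => k * s) k.
  by rewrite -[X in is_derive _ _ _ X]mulr1; exact: is_derive_Ml.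
have between (s a : R) : (0 <= s <= a) || (a <= s <= 0) -> `|a| < d -> `|s| < d.
  by case/orP => /andP[sa sb]; [rewrite !ger0_norm// | rewrite !ler0_norm//];
    lra.
rewrite (le_trans (ler_normD _ _))// [in leRHS](splitr eps) mulrDl lerD//.
  apply: (@le_trans _ _ (eps / 2 * `|h.1 - 0|)); last first.
    by rewrite subr0 ler_wpM2l ?(ltW e2)//= prod_normE le_max lexx.
  apply: (@mean_value_ineq _ (fun s => u (z.1 + s, z.2 + h.2) - d1 z * s)
    (fun s => d1 (z.1 + s, z.2 + h.2) - d1 z)) => s s0.
  have [dd1 _ ? _] := Bd s h.2 (between _ _ s0 h1d) h2d; split => //.
  by apply: is_deriveB; exact: is_derive_slice1.
apply: (@le_trans _ _ (eps / 2 * `|h.2 - 0|)); last first.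
  by rewrite subr0 ler_wpM2l ?(ltW e2)//= prod_normE le_max lexx orbT.
apply: (@mean_value_ineq _ (fun s => u (z.1, z.2 + s) - d2 z * s)
  (fun s => d2 (z.1, z.2 + s) - d2 z)) => s s0.
have [|_ + _ +] := Bd 0 s _ (between _ _ s0 h2d); first by rewrite normr0.
rewrite addr0 => dd2 ?; split => //.
by apply: is_deriveB; exact: is_derive_slice2.
Qed.

Lemma is_derive_path (R : realType) (u d1 d2 : R * R -> R) (x y : R -> R) (s dx
  dy : R) :
  (\forall w \near (x s, y s), C1_at u d1 d2 w) ->
  is_derive s 1 x dx -> is_derive s 1 y dy ->
  is_derive s 1 (fun t => u (x t, y t)) (d1 (x s, y s) * dx + d2 (x s, y s) *
    dy).
Proof.
move=> Hd [dx1 dxE] [dy1 dyE].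
have [du duE] := diff_of_partials Hd.
have xd : differentiable x s by apply/derivable1_diffP.
have yd : differentiable y s by apply/derivable1_diffP.
have pd : differentiable (fun t => (x t, y t)) s by exact: differentiable_pair.
have cd : differentiable (u \o (fun t => (x t, y t))) s by exact:
  differentiable_comp.
split; first exact: diff_derivable.
rewrite deriveE// diff_comp//= duE/= diff_pair//= -!deriveE// dxE dyE//.
Qed.

(** * Integrals over one turn of the circle *)

Definition circint (R : realType) (h : R -> R) : R :=
  (\int[lebesgue_measure]_(x in `[0, 2 * pi]) h x)%R.

Section circint.
Context {R : realType}.
Implicit Types h : R -> R.

Lemma measurable_circ :
  measurable (`[0, 2 * pi]%classic : set (measurableTypeR R)).
Proof. exact: measurable_itv. Qed.

Lemma circ_integrable h : continuous h ->
  (@lebesgue_measure R).-integrable `[0, 2 * pi]%classic (EFin \o h).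
Proof.
move=> ch; apply: continuous_compact_integrable; first exact: segment_compact.
exact: continuous_subspaceT.
Qed.

Lemma circintD h1 h2 : continuous h1 -> continuous h2 ->
  circint (fun x => h1 x + h2 x) = circint h1 + circint h2.
Proof. by move=> c1 c2; apply: RintegralD => //; exact: circ_integrable. Qed.

Lemma circintZ k h : continuous h -> circint (fun x => k * h x) = k * circint h.
Proof. by move=> c; apply: RintegralZl => //; exact: circ_integrable. Qed.

Lemma circint_cst (k : R) : circint (fun=> k) = k * (2 * pi).
Proof.
rewrite /circint Rintegral_cst//; congr (_ * _).
rewrite -[RHS]/(fine (2 * pi)%:E); congr fine.
apply: etrans (lebesgue_measure_itv `[(0 : R), 2 * pi]) _.
by rewrite /= lte_fin mulr_gt0 ?pi_gt0// sube0.
Qed.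

Lemma circint_le h (k : R) : continuous h -> (forall x, `|h x| <= k) ->
  `|circint h| <= k * (2 * pi).
Proof.
move=> ch hk; rewrite -circint_cst.
apply: (le_trans (le_normr_Rintegral _ (circ_integrable ch))) => //.
apply: le_Rintegral => //.
- apply: (circ_integrable (h := fun x => `|h x|)) => x.
  exact: (cvg_norm (ch x)).
- by apply: circ_integrable => x; exact: cvg_cst.
Qed.

Lemma circint_FTC h (H : R -> R) : continuous h -> (forall x : R, is_derive x 1
  H (h x)) ->
  circint h = H (2 * pi) - H 0.
Proof.
move=> ch dH.
have cH : continuous H.
  by move=> x; apply/differentiable_continuous/derivable1_diffP; have [] := dH
    x.
rewrite /circint /Rintegral (continuous_FTC2 (F := H))//.
- by rewrite mulr_gt0 ?pi_gt0.
- exact: continuous_subspaceT.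
- split; first by move=> x _; have [] := dH x.
  + exact/cvg_at_right_filter/cH.
  + exact/cvg_at_left_filter/cH.
- by move=> x _; rewrite derive1E; have [] := dH x.
Qed.

Lemma is_derive_circint (f df : R -> R -> R) (a b k : R) :
  (forall t, a < t < b -> continuous (f t)) ->
  (forall t x, a < t < b -> is_derive t 1 (f ^~ x) (df t x)) ->
  (forall t x, a < t < b -> `|df t x| <= k) ->
  forall t, a < t < b -> is_derive t 1 (fun t => circint (f t)) (circint (df
    t)).
Proof.
move=> fc fd dk t tab.
have Iab x : `]a, b[%classic x -> a < x < b by rewrite /= in_itv.
have k0 : 0 <= k by apply: le_trans (dk t 0 tab).
have dE x y : a < x < b -> partial1of2 f x y = df x y.
  by move=> /(fd _ y)[_ <-]; rewrite partial1of2E.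
have H1 x : `]a, b[%classic x ->
   (@lebesgue_measure R).-integrable `[0, 2 * pi]%classic (EFin \o f x).
  by move=> /Iab xab; exact/circ_integrable/fc.
have H2 (x y : R) : `]a, b[%classic x -> `[0, 2 * pi]%classic y -> derivable
  (f^~ y) x 1.
  by move=> /Iab /(fd _ y)[].
have H3 (x y : R) : `]a, b[%classic x -> `[0, 2 * pi]%classic y ->
  `|partial1of2 f x y| <= k.
  by move=> /Iab xab _; rewrite dE//; exact: dk.
have H4 : (@lebesgue_measure R).-integrable `[0, 2 * pi]%classic (EFin \o fun=>
  k).
  by apply: circ_integrable => x; exact: cvg_cst.
have Ht : `]a, b[%classic t by rewrite /= in_itv.
have D1 := derivable_under_integral measurable_circ Ht H1 H2 (fun=> k0) H4 H3.
have D2 := differentiation_under_integral measurable_circ Ht H1 H2 (fun=> k0)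
  H4 H3.
split; first exact: D1.
rewrite -derive1E [LHS]D2; congr Rintegral; apply/funext => y.
exact: dE.
Qed.

End circint.

(** * Complex-valued paths and their integrals, by real and imaginary parts *)

Local Notation normc := ComplexField.Normc.normc.

Section complex_paths.
Context {R : realType}.
Local Notation C := (R[i]).
Implicit Types (z w c d : C) (p q h : R -> C).

(** The boolean index lets one statement cover both parts, so that each complex fact reduces to a
    real one. *)
Definition part (b : bool) (z : C) : R := if b then Re z else Im z.

Lemma part_inj z w : (forall b, part b z = part b w) -> z = w.
Proof.
case: z w => [a b] [c d] H.
by have /= -> := H true; have /= -> := H false.
Qed.

Lemma partD b z w : part b (z + w) = part b z + part b w.
Proof. by case: b z w => -[? ?] [? ?]. Qed.

Lemma partM b z w : part b (z * w) =
  if b then part true z * part true w - part false z * part false w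
  else part true z * part false w + part false z * part true w.
Proof. by case: b z w => -[? ?] [? ?]. Qed.

Lemma ler_part b z : `|part b z| <= normc z.
Proof.
by case: b z => -[x y] /=; rewrite -sqrtr_sqr ler_sqrt ?addr_ge0 ?sqr_ge0//
  ?lerDl ?lerDr sqr_ge0.
Qed.

Lemma ler_normc z : normc z <= `|Re z| + `|Im z|.
Proof.
case: z => x y /=; rewrite -[leRHS]ger0_norm ?addr_ge0// -sqrtr_sqr.
rewrite ler_sqrt ?sqr_ge0// sqrrD !real_normK ?num_real// -subr_ge0.
by rewrite (_ : _ - _ = `|x| * `|y| *+ 2) ?mulrn_wge0 ?mulr_ge0//; ring.
Qed.

Lemma normc_ge0 z : 0 <= normc z.
Proof. by case: z => x y; exact: sqrtr_ge0. Qed.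

Lemma normcX z (n : nat) : normc (z ^+ n) = normc z ^+ n.
Proof.
elim: n => [|n IH]; first by rewrite !expr0 ComplexField.Normc.normc1.
by rewrite !exprS ComplexField.Normc.normcM IH.
Qed.

Definition ccont_at q (s : R) := forall b, {for s, continuous (fun t => part b
  (q t))}.

Lemma ccont_cst c s : ccont_at (fun=> c) s.
Proof. by move=> b; exact: cvg_cst. Qed.

Lemma ccontD p q s : ccont_at p s -> ccont_at q s -> ccont_at (fun t => p t + q
  t) s.
Proof.
move=> cp cq b; rewrite (_ : (fun t => _) = (fun t => part b (p t) + part b (q
  t))).
  exact: cvgD (cp b) (cq b).
by apply/funext => t; rewrite partD.
Qed.

Lemma ccontM p q s : ccont_at p s -> ccont_at q s -> ccont_at (fun t => p t * q
  t) s.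
Proof.
move=> cp cq b; rewrite (_ : (fun t => _) = (fun t =>
  if b then part true (p t) * part true (q t) - part false (p t) * part false
    (q t)
  else part true (p t) * part false (q t) + part false (p t) * part true (q
    t))).
  by case: b; [apply: cvgB|apply: cvgD]; apply: cvgM; (apply: cp || apply: cq).
by apply/funext => t; rewrite partM.
Qed.

Lemma ccontX q s (n : nat) : ccont_at q s -> ccont_at (fun t => q t ^+ n) s.
Proof.
move=> cq; elim: n => [|n IH]; first exact: ccont_cst.
rewrite (_ : (fun t => _) = (fun t => q t * q t ^+ n)); first exact: ccontM.
by apply/funext => t; rewrite exprS.
Qed.

Lemma ccontV q s : q s != 0 -> ccont_at q s -> ccont_at (fun t => (q t)^-1) s.
Proof.
move=> q0 cq.
have cn : {for s, continuous (fun t => part true (q t) ^+ 2 + part false (q t)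
  ^+ 2)}.
  by apply: cvgD; apply: cvgM; apply: cq.
have n0 : part true (q s) ^+ 2 + part false (q s) ^+ 2 != 0.
  move: q0; case: (q s) => x y; rewrite eq_complex/= => H.
  by rewrite paddr_eq0 ?sqr_ge0// !sqrf_eq0.
move=> b; rewrite (_ : (fun t => _) = (fun t => (if b then part true (q t)
  else - part false (q t)) * (part true (q t) ^+ 2 + part false (q t) ^+
    2)^-1)).
  by apply: cvgM; [case: b; [exact: cq|apply: cvgN; exact: cq]|exact: cvgV].
by apply/funext => t; case: (q t) b => x y [] //=; rewrite mulNr.
Qed.

Definition cderiv q (s : R) d := forall b, is_derive s 1 (fun t => part b (q
  t)) (part b d).

Lemma cderiv_ccont q s d : cderiv q s d -> ccont_at q s.
Proof.
move=> dq b; apply/differentiable_continuous/derivable1_diffP.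
by have [] := dq b.
Qed.

Lemma cderivMl c q s d : cderiv q s d -> cderiv (fun t => c * q t) s (c * d).
Proof.
move=> dq b; rewrite (_ : (fun t => _) = (fun t =>
  if b then part true c * part true (q t) - part false c * part false (q t)
  else part true c * part false (q t) + part false c * part true (q t))).
  by rewrite partM; case: b; [apply: is_deriveB|apply: is_deriveD];
    apply: is_derive_Ml; exact: dq.
by apply/funext => t; rewrite partM.
Qed.

Lemma cderivMr c q s d : cderiv q s d -> cderiv (fun t => q t * c) s (d * c).
Proof.
move=> /(cderivMl c); rewrite mulrC; congr cderiv.
by apply/funext => t; rewrite mulrC.
Qed.

Lemma cderiv_cst c s : cderiv (fun=> c) s 0.
Proof. by move=> b; rewrite (_ : part b 0 = 0); [exact: is_derive_cst|case: b].
  Qed.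

Lemma cderivD p q s c d : cderiv p s c -> cderiv q s d -> cderiv (fun t => p t
  + q t) s (c + d).
Proof.
move=> dp dq b; rewrite (_ : (fun t => _) = (fun t => part b (p t) + part b (q
  t))).
  by rewrite partD; apply: is_deriveD; [exact: dp|exact: dq].
by apply/funext => t; rewrite partD.
Qed.

Definition cint h : C := Complex (circint (fun t => Re (h t))) (circint (fun t
  => Im (h t))).

Lemma part_cint b h : part b (cint h) = circint (fun t => part b (h t)).
Proof. by case: b. Qed.

Lemma cintD p q : (forall s, ccont_at p s) -> (forall s, ccont_at q s) ->
  cint (fun t => p t + q t) = cint p + cint q.
Proof.
move=> cp cq; apply: part_inj => b; rewrite partD !part_cint -circintD.
- by congr circint; apply/funext => t; rewrite partD.
- by move=> s; exact: cp.
- by move=> s; exact: cq.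
Qed.

Lemma cintZ c q : (forall s, ccont_at q s) -> cint (fun t => c * q t) = c *
  cint q.
Proof.
move=> cq; have cqb b : continuous (fun t => part b (q t)) by move=> s; exact:
  cq.
have cqbM b k : continuous (fun t => k * part b (q t)).
  by move=> s; apply: cvgM; [exact: cvg_cst|exact: cqb].
apply: part_inj => b; rewrite part_cint partM !part_cint.
case: b; rewrite -!circintZ//; last first.
  by rewrite -circintD//; congr circint; apply/funext => t; rewrite partM.
rewrite -[in RHS]mulN1r -circintZ// -circintD//.
  by congr circint; apply/funext => t; rewrite partM mulN1r.
by move=> s; apply: cvgM; [exact: cvg_cst|exact: cqbM].
Qed.

Lemma ler_cint h (k : R) : (forall s, ccont_at h s) -> (forall s, normc (h s)
  <= k) ->
  forall b, `|part b (cint h)| <= k * (2 * pi).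
Proof.
move=> ch hk b; rewrite part_cint; apply: circint_le; first by move=> s; exact:
  ch.
by move=> s; exact: le_trans (ler_part _ _) (hk s).
Qed.

(** The two parts are bounded separately, hence [4 * pi] in place of the sharp [2 * pi]; the value
    of the constant is irrelevant below. *)
Lemma normc_cint h (k : R) : (forall s, ccont_at h s) -> (forall s, normc (h s)
  <= k) ->
  normc (cint h) <= k * (4 * pi).
Proof.
move=> ch hk; apply: (le_trans (ler_normc _)).
rewrite (_ : k * (4 * pi) = k * (2 * pi) + k * (2 * pi)); last by ring.
by rewrite lerD//; [exact: (ler_cint ch hk true)|exact: (ler_cint ch hk false)].
Qed.

Lemma cint_cst1 : cint (fun=> 1) = Complex (2 * pi) 0.
Proof. by rewrite /cint/= !circint_cst mul1r mul0r. Qed.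

Definition zeta (t : R) : C := Complex (cos t) (sin t).

Lemma normc_zeta t : normc (zeta t) = 1.
Proof. by rewrite /= cos2Dsin2 sqrtr1. Qed.

Lemma zeta_neq0 t : zeta t != 0.
Proof.
apply/eqP => z0; have := normc_zeta t; rewrite z0 ComplexField.Normc.normc0.
by move/eqP; rewrite eq_sym oner_eq0.
Qed.

Lemma cderiv_zeta t : cderiv zeta t (Complex 0 1 * zeta t).
Proof.
case; rewrite /part/= ?mul0r ?mul1r ?sub0r ?add0r; [exact: is_derive_cos|exact:
  is_derive_sin].
Qed.

Lemma zeta_2pi : zeta (2 * pi) = zeta 0.
Proof. by rewrite /zeta mulr_natl cos2pi sin2pi cos0 sin0. Qed.

End complex_paths.

(** * Zeros near the origin of a holomorphic function on the disc of radius 4 *)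

Section local_dichotomy.
Context {R : realType}.
Local Notation C := (R[i]).
Variables (g dg : C -> C) (M : R).

(** Complex differentiability is used only through paths: [dg] acts as the complex derivative of [g]
    by multiplying the velocity. Radius 4 leaves room for paths that run past the unit circle. *)
Hypothesis chain : forall (q : R -> C) (s : R) (d : C),
  normc (q s) < 4 -> cderiv q s d -> cderiv (fun t => g (q t)) s (dg (q s) * d).
Hypothesis dg_cont : forall (q : R -> C) (s : R),
  normc (q s) < 4 -> ccont_at q s -> ccont_at (fun t => dg (q t)) s.
Hypothesis g_bnd : forall z, normc z < 4 -> normc (g z) <= M.
Hypothesis dg_bnd : forall z, normc z < 4 -> normc (dg z) <= M.

Import ComplexField.Normc.

(** Since [d zeta = i zeta dt], this is the Cauchy kernel [d zeta / (zeta - w)] written in the angle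
    t, up to the factor i. *)
Let kern (w : C) (t : R) : C := (1 - w * (zeta t)^-1)^-1.

Let normc_zetaV t : normc (zeta t : C)^-1 = 1.
Proof. by rewrite normcV normc_zeta invr1. Qed.

Let M0 : 0 <= M.
Proof. by apply: le_trans (normc_ge0 _) (g_bnd (z := 0) _); rewrite normc0. Qed.

Section fixed_w.
Variable w : C.
Hypothesis w2 : normc w <= 2^-1.

Let den_ge t : 2^-1 <= normc (1 - w * (zeta t)^-1).
Proof.
have : normc (1 : C) <= normc (1 - w * (zeta t)^-1) + normc (w * (zeta t)^-1).
  by rewrite -[X in normc X <= _](subrK (w * (zeta t)^-1)); exact: le_normcD.
rewrite normcM normc_zetaV mulr1 normc1 => H.
rewrite -(lerD2r (normc w)); apply: le_trans H.
by rewrite [leRHS](splitr 1) div1r lerD2l.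
Qed.

Let den_neq0 t : 1 - w * (zeta t)^-1 != 0.
Proof.
by apply/eqP => d0; have := den_ge t; rewrite d0 normc0 leNgt invr_gt0 ltr0n.
Qed.

Let kern_le t : normc (kern w t) <= 2.
Proof.
rewrite normcV -[leRHS]invrK lef_pV2 ?posrE ?invr_gt0//.
by apply: lt_le_trans (den_ge t); rewrite invr_gt0.
Qed.

(** One step of the geometric expansion; it drives both the non-vanishing of the kernel integral and
    the Taylor formula. *)
Let kernE t : kern w t = 1 + w * (zeta t)^-1 * kern w t.
Proof.
rewrite -[X in _ = X + _](mulVf (den_neq0 t)) -/(kern w t).
by move: (kern w t) (w * _) => k a; ring.
Qed.

Let zetaV_cont s : ccont_at (fun t => (zeta t : C)^-1) s.
Proof. by apply: ccontV; [exact: zeta_neq0|exact: cderiv_ccont (cderiv_zeta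
  s)]. Qed.

Let kern_cont s : ccont_at (kern w) s.
Proof.
apply: ccontV; first exact: den_neq0.
apply: ccontD; first exact: ccont_cst.
rewrite (_ : (fun t => _) = (fun t => - w * (zeta t)^-1)).
  by apply: ccontM; [exact: ccont_cst|exact: zetaV_cont].
by apply/funext => t; rewrite mulNr.
Qed.

(** Segment from w (t = 0) to the point of the circle at angle x (t = 1): a homotopy between the
    circle and the constant w. *)
Let q (t x : R) : C := w + (Complex t 0) * (zeta x - w).

(** The range ]-1, 2[ is an open interval around [0, 1], so that derivatives in t exist at both
    ends; there [q] has modulus at most 1/2 + 2 * 3/2 = 7/2. *)
Let q_lt4 (t x : R) : -1 < t < 2 -> normc (q t x) < 4.
Proof.
move=> /andP[t1 t2]; apply: (@le_lt_trans _ _ (normc w + `|t| * (1 + normc w))).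
  apply: (le_trans (le_normcD _ _)); rewrite lerD2l normcM.
  rewrite [X in X * _ <= _]/= expr0n/= addr0 sqrtr_sqr ler_wpM2l//.
  by apply: (le_trans (le_normcD _ _)); rewrite normcN normc_zeta.
have t3 : `|t| <= 2 by rewrite ler_norml; apply/andP; split; lra.
move: (normc_ge0 w) w2; move: (normc w : R) => r r0 r2.
have : `|t| * (1 + r) <= 2 * (3 / 2) by rewrite ler_pM//; lra.
lra.
Qed.

Let q_dt t x : cderiv (q ^~ x) t (zeta x - w).
Proof.
rewrite -[X in cderiv _ _ X]add0r; apply: cderivD; first exact: cderiv_cst.
rewrite -[X in cderiv _ _ X]mul1r; apply: cderivMr.
by case; [exact: is_derive_id|exact: is_derive_cst].
Qed.

Let q_dx t x : cderiv (q t) x (Complex t 0 * (Complex 0 1 * zeta x)).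
Proof.
rewrite -[X in cderiv _ _ X]add0r; apply: cderivD; first exact: cderiv_cst.
apply: cderivMl; rewrite -[X in cderiv _ _ X]addr0; apply: cderivD.
  exact: cderiv_zeta.
exact: cderiv_cst.
Qed.

Let dgq_cont (t x : R) : -1 < t < 2 -> ccont_at (fun x => dg (q t x) * zeta x)
  x.
Proof.
move=> t2; apply: ccontM; last exact: cderiv_ccont (cderiv_zeta x).
apply: (dg_cont (q := q t)); first exact: q_lt4.
exact: cderiv_ccont (q_dx t x).
Qed.

(** Multiplied by t, the integrand is the derivative in x of [- i * g (q t x)], which takes the same
    value at 0 and [2 * pi]. Cancelling t is why t = 0 is left out. *)
Let cint_dgq (t : R) : 0 < t < 1 -> cint (fun x => dg (q t x) * zeta x) = 0.
Proof.
move=> /andP[t0 t1].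
have t2 : -1 < t < 2 by apply/andP; split; lra.
have tC : Complex t 0 != 0 :> C by rewrite eq_complex/= (gt_eqF t0).
apply: (mulfI tC); rewrite mulr0 -cintZ; last by move=> s; exact: dgq_cont.
have dH x : cderiv (fun x => - Complex 0 1 * g (q t x)) x (Complex t 0 * (dg (q
  t x) * zeta x)).
  have := cderivMl (- Complex 0 1) (chain (q_lt4 x t2) (q_dx t x)).
  rewrite (_ : - _ * _ = Complex t 0 * (dg (q t x) * zeta x))//.
  have ii : (Complex 0 1 : C) * Complex 0 1 = -1 by exact: sqr_i.
  transitivity (- (Complex 0 1 * Complex 0 1) * (Complex t 0 * (dg (q t x) *
    zeta x))); first by ring.
  by rewrite ii opprK mul1r.
apply: part_inj => b; rewrite part_cint.
have hc : continuous (fun x => part b (Complex t 0 * (dg (q t x) * zeta x))).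
  by move=> s; apply: ccontM; [exact: ccont_cst|exact: dgq_cont].
rewrite (circint_FTC hc (fun s => dH s b)).
by rewrite /q zeta_2pi subrr; case: b {hc}.
Qed.

Lemma Cauchy_kernel : g w * cint (kern w) = cint (fun t => g (zeta t) * kern w
  t).
Proof.
have gq_cont (t x : R) : -1 < t < 2 -> ccont_at (fun x => g (q t x) * kern w x)
  x.
  move=> t2; apply: ccontM; last exact: kern_cont.
  exact: cderiv_ccont (chain (q_lt4 x t2) (q_dx t x)).
(* As [zeta - w = zeta * (1 - w / zeta)], the factor [zeta - w] produced by differentiating in t
   cancels the denominator of the kernel. *)
have gq_dt (t x : R) : -1 < t < 2 ->
    cderiv (fun t => g (q t x) * kern w x) t (dg (q t x) * zeta x).
  move=> t2; have := cderivMr (kern w x) (chain (q := q ^~ x) (q_lt4 x t2)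
    (q_dt t x)).
  congr cderiv; rewrite -mulrA; congr (_ * _); rewrite /kern.
  have := zeta_neq0 x; have := den_neq0 x; move: (zeta x) => z d0 z0.
  rewrite (_ : z - w = z * (1 - w / z)) ?mulfK//.
  by rewrite mulrBr mulr1 mulrCA mulfV// mulr1.
pose Phi t := cint (fun x => g (q t x) * kern w x).
have dPhi (t : R) b : -1 < t < 2 -> is_derive t 1 (fun t => part b (Phi t))
    (part b (cint (fun x => dg (q t x) * zeta x))).
  move=> t2; rewrite part_cint (_ : (fun t => part b (Phi t)) =
    (fun t => circint (fun x => part b (g (q t x) * kern w x)))); last first.
    by apply/funext => s; rewrite part_cint.
  apply: (@is_derive_circint R (fun t x => part b (g (q t x) * kern w x))
     (fun t x => part b (dg (q t x) * zeta x)) (-1) 2 M) => //.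
  - by move=> s s2 x; exact: gq_cont.
  - by move=> s x s2; exact: gq_dt.
  - move=> s x s2; apply: le_trans (ler_part _ _) _.
    by rewrite normcM normc_zeta mulr1; exact/dg_bnd/q_lt4.
(* The derivative of [Phi] vanishes on ]0, 1[ by [cint_dgq]; at the ends only continuity is
   needed. *)
have E : Phi 1 = Phi 0.
  apply: part_inj => b; apply/eqP; rewrite -subr_eq0; apply/eqP.
  have [||c _ ->] := @MVT _ (fun t => part b (Phi t)) (fun=> 0) 0 1 ltr01.
  - move=> x; rewrite in_itv/= => x01.
    have /(dPhi _ b) : -1 < x < 2 by case/andP: x01 => ? ?; apply/andP; split;
      lra.
    by rewrite cint_dgq//; case: b.
  - apply: derivable_within_continuous => x; rewrite in_itv/= => /andP[x0 x1].
    have /(dPhi _ b) [] // : -1 < x < 2 by apply/andP; split; lra.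
  - by rewrite mul0r.
have -> : cint (fun t => g (zeta t) * kern w t) = Phi 1.
  by congr cint; apply/funext => x; rewrite /q -[Complex 1 0]/(1 : C) mul1r
    addrC subrK.
rewrite E -cintZ//; congr cint; apply/funext => x.
by rewrite /q -[Complex 0 0]/(0 : C) mul0r addr0.
Qed.

(** Were the integral zero, expanding the kernel once would give the integral of [w / zeta * kern w]
    the value [- (2 * pi)], while the bound 2 on the kernel keeps its real part smaller than
    [2 * pi] in size when |w| < 1/2. *)
Lemma cint_kern_neq0 : normc w < 2^-1 -> cint (kern w) != 0.
Proof.
move=> w2'; apply/eqP => K0.
have cc s : ccont_at (fun t => w * (zeta t)^-1 * kern w t) s.
  by apply: ccontM => //; apply: ccontM => //; exact: ccont_cst.
have := @ler_cint R (fun t => w * (zeta t)^-1 * kern w t) (normc w * 2) cc.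
have E : cint (kern w) = Complex (2 * pi) 0 + cint (fun t => w * (zeta t)^-1 *
  kern w t).
  rewrite -cint_cst1 -cintD//; last by move=> s; exact: ccont_cst.
  by congr cint; apply/funext => t; exact: kernE.
have {E} -> : cint (fun t => w * (zeta t)^-1 * kern w t) = Complex (- (2 * pi))
  0.
  rewrite K0 in E; apply: (addrI (Complex (2 * pi) 0)); rewrite -E.
  by apply/eqP; rewrite eq_complex/= subrr addr0 !eqxx.
move=> /(_ _ true); rewrite /= normrN gtr0_norm ?mulr_gt0 ?pi_gt0// => H.
have : 2 * pi <= normc w * 2 * (2 * pi :> R).
  apply: H => s; rewrite normcM normcM normc_zetaV mulr1 ler_wpM2l//.
  exact: normc_ge0.
have := @pi_gt0 R; nra.
Qed.

(** Induction on k: when the kernel in the remainder is expanded once more, the summand 1 yields the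
    next coefficient and the rest the new remainder. The coefficients do not depend on w. *)
Lemma Taylor_kernel (k : nat) : g w * cint (kern w) =
  (\sum_(j < k) w ^+ j * cint (fun t => g (zeta t) * (zeta t)^-1 ^+ j))
  + w ^+ k * cint (fun t => g (zeta t) * (zeta t)^-1 ^+ k * kern w t).
Proof.
have gz_cont s : ccont_at (fun t => g (zeta t)) s.
  apply: (cderiv_ccont (chain (q := zeta) _ (cderiv_zeta s))).
  by rewrite normc_zeta ltr1n.
have gzX_cont j s : ccont_at (fun t => g (zeta t) * (zeta t)^-1 ^+ j) s.
  by apply: ccontM => //; exact: ccontX.
elim: k => [|k ->].
  rewrite big_ord0 add0r expr0 mul1r Cauchy_kernel; congr cint.
  by apply/funext => t; rewrite expr0 mulr1.
rewrite big_ord_recr/= -addrA; congr (_ + _).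
rewrite [w ^+ k.+1]exprSr -mulrA -mulrDr; congr (_ * _).
rewrite -cintZ; last by move=> s; exact: ccontM.
rewrite -cintD//; last first.
  by move=> s; apply: ccontM; [exact: ccont_cst|exact: ccontM].
congr cint; apply/funext => t; rewrite {1}kernE exprS.
by move: (g _) (kern w t) (zeta t)^-1 => a b c'; ring.
Qed.

Lemma Taylor_remainder (k : nat) :
  normc (cint (fun t => g (zeta t) * (zeta t)^-1 ^+ k * kern w t)) <= M * 2 *
    (4 * pi).
Proof.
have z4 s : normc (zeta s : C) < 4 by rewrite normc_zeta ltr1n.
apply: normc_cint => s.
  apply: ccontM => //; apply: ccontM; last exact: ccontX.
  exact: (cderiv_ccont (chain (q := zeta) (z4 s) (cderiv_zeta s))).
rewrite normcM ler_pM ?normc_ge0// normcM normcX normc_zetaV expr1n mulr1.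
exact: g_bnd.
Qed.

End fixed_w.

Lemma zero_or_isolated :
  (exists2 d : R, 0 < d & forall z, normc z < d -> g z = 0) \/
  (exists2 d : R, 0 < d & forall z, z != 0 -> normc z < d -> g z != 0).
Proof.
pose c j := cint (fun t => g (zeta t) * (zeta t)^-1 ^+ j).
pose B := M * 2 * (4 * pi) + 1.
have B0 : 0 < B by rewrite ltr_wpDl// !mulr_ge0// pi_ge0.
have [c0|] := pselect (forall j, c j = 0).
  left; exists 2^-1; first by rewrite invr_gt0.
  move=> z z2; apply/eqP; rewrite -(mulIr_eq0 _ (mulIf (cint_kern_neq0 (ltW z2)
    z2))).
  apply/eqP/eq0_normc/eqP; rewrite eq_le normc_ge0 andbT.
  (* With all coefficients zero only the remainder is left, and its bound is uniform in k. A
     positive value would then be contradicted by any k > B / x, as k < 2 ^ k. *)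
  have Ek k : normc (g z * cint (kern z)) <= 2^-1 ^+ k * B.
    rewrite (Taylor_kernel (ltW z2) k) big1 ?add0r; last first.
      by move=> i _; rewrite -/(c i) c0 mulr0.
    rewrite normcM normcX ler_pM ?exprn_ge0 ?normc_ge0//.
      by rewrite lerXn2r ?nnegrE ?normc_ge0 ?invr_ge0// ltW.
    by rewrite (le_trans (Taylor_remainder (ltW z2) _))// lerDl.
  rewrite leNgt; apply/negP; move: Ek; move: (normc _ : R) => x Ek x0.
  have := archi_boundP (divr_ge0 (ltW B0) (ltW x0)).
  set k := Num.bound _ => kB.
  have := Ek k; apply/negP; rewrite -ltNge exprVn mulrC ltr_pdivrMr
    ?exprn_gt0//.
  rewrite mulrC -ltr_pdivrMr// (lt_le_trans kB)// -natrX ler_nat.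
  exact/ltnW/ltn_expl.
move=> /existsNP[j0 /eqP cj0].
have [m cm min_m] := @ex_minnP (fun j => c j != 0) (ex_intro _ j0 cj0).
right.
have cm0 : 0 < normc (c m).
  by rewrite lt_neqAle normc_ge0 andbT eq_sym; apply: contra cm =>
    /eqP/eq0_normc ->.
(* The bound 1/2 gives access to the Taylor formula. At a zero z of g with z != 0, dividing that
   formula by [z ^+ m] would give |c m| <= |z| * B, which the second bound excludes. *)
exists (Num.min 2^-1 (normc (c m) / B)).
  by rewrite lt_min invr_gt0 ltr0n divr_gt0.
move=> z z0; rewrite lt_min => /andP[z2 zB]; apply/eqP => gz.
have := Taylor_kernel (ltW z2) m.+1; rewrite gz mul0r big_ord_recr/=.
rewrite big1 ?add0r; last first.
  move=> i _; apply/eqP; rewrite mulf_eq0 orbC -/(c i).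
  by apply/orP; left; apply: contraT => /min_m; rewrite leqNgt ltn_ord.
rewrite -/(c m) exprSr -mulrA -mulrDr => /esym/eqP.
rewrite mulf_eq0 expf_eq0 (negPf z0) andbF/= addr_eq0 => /eqP cmE.
have : normc (c m) <= normc z * B.
  rewrite cmE normcN normcM ler_wpM2l ?normc_ge0//.
  by rewrite (le_trans (Taylor_remainder (ltW z2) _))// lerDl.
by rewrite leNgt -ltr_pdivlMr ?zB.
Qed.

End local_dichotomy.

(** * Isolation of zeros for pairs satisfying the Cauchy-Riemann equations *)

Lemma continuous_at_pair (R : realType) (x y : R -> R) (s : R) :
  {for s, continuous x} -> {for s, continuous y} ->
  {for s, continuous (fun t => (x t, y t))}.
Proof. by move=> cx cy; exact: (cvg_pair cx cy). Qed.

(** Only the derivatives in the first variable are named; writing those in the second as [- vx] and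
    [ux] encodes the Cauchy-Riemann equations. *)
Definition CR_at (R : realType) (u v ux vx : R * R -> R) (z : R * R) : Prop :=
  C1_at u ux (fun z => - vx z) z /\ C1_at v vx ux z.

Lemma C1_at_continuous (R : realType) (u d1 d2 : R * R -> R) (z : R * R) :
  (\forall w \near z, C1_at u d1 d2 w) -> {for z, continuous u}.
Proof.
by move=> /diff_of_partials du; apply: differentiable_continuous; have [] := du.
Qed.

Lemma near_le_bound (R : realType) (u : R * R -> R) (z : R * R) (k : R) :
  {for z, continuous u} -> `|u z| < k -> \forall w \near z, `|u w| <= k.
Proof.
move=> cu uk; have /cvgrPdist_le cu' := cu.
have k0 : 0 < k - `|u z| by rewrite subr_gt0.
apply: filterS (cu' _ k0) => w wk.
rewrite -[u w](subrK (u z)) (le_trans (ler_normD _ _))// -lerBrDr distrC//.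
Qed.

Lemma CR_zero_or_isolated (R : realType) (u v ux vx : R * R -> R) (p : R * R) :
  (\forall z \near p, CR_at u v ux vx z) ->
  (\forall z \near p, u z = 0 /\ v z = 0) \/
  (\forall z \near p, z != p -> ~ (u z = 0 /\ v z = 0)).
Proof.
move=> H.
have Hu : \forall z \near p, C1_at u ux (fun z => - vx z) z by apply: filterS H
  => z [].
have Hv : \forall z \near p, C1_at v vx ux z by apply: filterS H => z [].
have cu := C1_at_continuous Hu; have cv := C1_at_continuous Hv.
have [_ _ cvx cux] := nbhs_singleton Hv.
(* The added 1 makes the bounds at p strict, so that they persist nearby by [near_le_bound]. *)
pose K := `|u p| + `|v p| + `|ux p| + `|vx p| + 1.
have [Ku Kv Kux Kvx] : [/\ `|u p| < K, `|v p| < K, `|ux p| < K & `|vx p| < K].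
  have := normr_ge0 (u p); have := normr_ge0 (v p).
  have := normr_ge0 (ux p); have := normr_ge0 (vx p).
  by rewrite /K => *; split; lra.
have K0 : 0 <= K by apply: le_trans (ltW Ku).
have [r /= r0 Br] : nbhs_ball p [set z | CR_at u v ux vx z /\
    ((`|u z| <= K /\ `|v z| <= K) /\ (`|ux z| <= K /\ `|vx z| <= K))].
  apply/nbhs_ballP; apply: filterI => //; apply: filterI; apply: filterI;
  exact: near_le_bound.
(* The map [P] below must send the disc of radius 4, where [zero_or_isolated] works, into the ball
   of radius r. *)
pose rho := r / 4.
have rho0 : 0 < rho by rewrite divr_gt0.
pose P (c : R[i]) : R * R := (p.1 + rho * Re c, p.2 + rho * Im c).
have P4 c : normc c < 4 -> ball p r (P c).
  move=> c4.
  have E (x : R) : `|x| <= normc c -> `|rho * x| < r.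
    move=> xc; rewrite normrM gtr0_norm// -[ltRHS](divfK (_ : 4 != 0))//.
    by rewrite ltr_pM2l// (le_lt_trans xc).
  by split; rewrite /ball/= opprD addNKr normrN; apply: E;
    [exact: (ler_part true)|exact: (ler_part false)].
have openB z : ball p r z -> \forall w \near z, ball p r w.
  by move=> pz; apply: open_nbhs_nbhs; split => //; exact: ball_open.
pose g c : R[i] := Complex (u (P c)) (v (P c)).
pose dg c : R[i] := Complex (rho * ux (P c)) (rho * vx (P c)).
have normc_le (x y k : R) : `|x| <= k -> `|y| <= k -> normc (Complex x y) <= 2
  * k.
  by move=> xk yk; rewrite (le_trans (ler_normc _))//= mulr_natl mulr2n lerD.
have chain (q : R -> R[i]) (s : R) (d : R[i]) : normc (q s) < 4 -> cderiv q s d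
  ->
    cderiv (fun t => g (q t)) s (dg (q s) * d).
  move=> /P4 Pq dq.
  have dq1 : is_derive s 1 (fun t => p.1 + rho * Re (q t)) (rho * Re d).
    rewrite -[X in is_derive _ _ _ X]add0r.
    by apply: is_deriveD; exact: (is_derive_Ml rho (dq true)).
  have dq2 : is_derive s 1 (fun t => p.2 + rho * Im (q t)) (rho * Im d).
    rewrite -[X in is_derive _ _ _ X]add0r.
    by apply: is_deriveD; exact: (is_derive_Ml rho (dq false)).
  have nu : \forall w \near P (q s), C1_at u ux (fun z => - vx z) w.
    by apply: filterS (openB _ Pq) => w /Br[[]].
  have nv : \forall w \near P (q s), C1_at v vx ux w.
    by apply: filterS (openB _ Pq) => w /Br[[]].
  pose X t := p.1 + rho * Re (q t); pose Y t := p.2 + rho * Im (q t).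
  have du := is_derive_path (x := X) (y := Y) nu dq1 dq2.
  have dv := is_derive_path (x := X) (y := Y) nv dq1 dq2.
  case; rewrite partM /part/=.
    by apply: (is_derive_eq du); rewrite -/(P (q s)); ring.
  by apply: (is_derive_eq dv); rewrite -/(P (q s)); ring.
have dg_cont (q : R -> R[i]) (s : R) : normc (q s) < 4 -> ccont_at q s ->
    ccont_at (fun t => dg (q t)) s.
  move=> /P4 Pq cq.
  have cP : {for s, continuous (fun t => P (q t))}.
    apply: continuous_at_pair.
      by apply: cvgD; [exact: cvg_cst|apply: cvgM; [exact: cvg_cst|exact: (cq
        true)]].
    by apply: cvgD; [exact: cvg_cst|apply: cvgM; [exact: cvg_cst|exact: (cq
      false)]].
  have [[_ [_ _ cvx' cux']] _] := Br _ Pq.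
  by case; (apply: cvgM; first exact: cvg_cst);
    [apply: (continuous_comp cP)|apply: (continuous_comp cP)].
have g_bnd z : normc z < 4 -> normc (g z) <= 2 * K + 2 * (rho * K).
  move=> /P4/Br[_ [[? ?] _]]; rewrite (le_trans (normc_le _ _ K _ _))//.
  by rewrite lerDl !mulr_ge0// ltW.
have dg_bnd z : normc z < 4 -> normc (dg z) <= 2 * K + 2 * (rho * K).
  move=> /P4/Br[_ [_ [? ?]]]; rewrite (le_trans (normc_le _ _ (rho * K) _ _))//.
  - by rewrite normrM gtr0_norm// ler_pM2l.
  - by rewrite normrM gtr0_norm// ler_pM2l.
  - by rewrite lerDr !mulr_ge0.
pose Q (z : R * R) : R[i] := Complex ((z.1 - p.1) / rho) ((z.2 - p.2) / rho).
have PQ z : P (Q z) = z.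
  rewrite /P/= ![rho * _]mulrC !divfK ?gt_eqF// ![p.1 + _]addrC ![p.2 + _]addrC
    !subrK.
  by rewrite -surjective_pairing.
have Qnear d : 0 < d -> \forall z \near p, normc (Q z) < d.
  move=> d0; apply/nbhs_ballP; exists (rho * (d / 2)); first by rewrite /=
    mulr_gt0// divr_gt0.
  move=> z [z1 z2]; rewrite (le_lt_trans (ler_normc _))//= (splitr d).
  rewrite /ball/= in z1 z2.
  by rewrite ltrD// normrM normfV (gtr0_norm rho0) ltr_pdivrMr// mulrC distrC.
have [[d d0 gd]|[d d0 gd]] := zero_or_isolated chain dg_cont g_bnd dg_bnd.
  left; apply: filterS (Qnear d d0) => z /gd.
  by rewrite /g PQ => -[-> ->].
right; apply: filterS (Qnear d d0) => z zd zp [uz vz].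
have : g (Q z) != 0.
  apply: gd => //; apply: contra zp; rewrite eq_complex/= => /andP[].
  rewrite !mulf_eq0 !invr_eq0 (gt_eqF rho0) !orbF !subr_eq0 => /eqP z1 /eqP z2.
  by rewrite (surjective_pairing z) z1 z2 -surjective_pairing.
by rewrite /g PQ uz vz eqxx.
Qed.

(** If isolation fails at one point of E, the interior N of the zero set meets E, and its trace on E
    is open and closed in E, hence all of E. *)
Lemma CR_identity (R : realType) (u v ux vx : R * R -> R) (E : set (R * R)) :
  open E -> connected E -> (forall z, E z -> CR_at u v ux vx z) ->
  (forall z, E z -> u z = 0 /\ v z = 0) \/
  (forall p, E p -> \forall z \near p, z != p -> ~ (u z = 0 /\ v z = 0)).
Proof.
move=> oE cE HE.
have dich p : E p -> (\forall z \near p, u z = 0 /\ v z = 0) \/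
    (\forall z \near p, z != p -> ~ (u z = 0 /\ v z = 0)).
  move=> Ep; apply: (@CR_zero_or_isolated _ u v ux vx).
  by apply: filterS (open_nbhs_nbhs (conj oE Ep)) => z /HE.
have [?|] := pselect (forall p, E p -> \forall z \near p, z != p -> ~ (u z = 0
  /\ v z = 0)).
  by right.
move=> /existsNP[p /not_implyP[Ep pN]]; left.
have pZ : \forall z \near p, u z = 0 /\ v z = 0 by have [] := dich p Ep.
pose N : set (R * R) := interior [set z | u z = 0 /\ v z = 0].
have EN : E `&` N = E.
  apply: cE.
  - by exists p; split.
  - by exists N => //; exact: open_interior.
  - exists (closure (E `&` N)); first exact: closed_closure.
    rewrite eqEsubset; split => z [Ez Nz]; first by split => //; exact:
      subset_closure.
    (* If z were the only possible zero near z, a nearby point of N would have to be z itself; so a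
       limit of points of N lies in N in either case. *)
    split => //; have [//|iz] := dich z Ez.
    have [w [[Ew Nw] /= zw]] := Nz _ iz.
    have [<-//|/zw wz] := eqVneq w z.
    by exfalso; apply: wz; exact: (nbhs_singleton Nw).
by move=> z; rewrite -EN => -[_ Nz]; exact: (nbhs_singleton Nz).
Qed.

(** * From vector-valued functions to scalar Cauchy-Riemann pairs *)

Definition lform (R : realType) (n : nat) (l : 'rV[R]_n -> R) :=
  forall (a : R) x y, l (a *: x + y) = a * l x + l y.

Section lform.
Context {R : realType} {n : nat} (l : 'rV[R]_n -> R).
Hypothesis ll : lform l.

Lemma lform0 : l 0 = 0.
Proof.
by have := ll 1 0 0; rewrite scale1r addr0 mul1r => /eqP; rewrite -subr_eq0
  opprD addNKr oppr_eq0 => /eqP.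
Qed.

Lemma lformZ a x : l (a *: x) = a * l x.
Proof. by rewrite -[a *: x]addr0 ll lform0 addr0. Qed.

Lemma lformD x y : l (x + y) = l x + l y.
Proof. by rewrite -[x in LHS]scale1r ll mul1r. Qed.

Lemma lformN x : l (- x) = - l x.
Proof. by rewrite -scaleN1r lformZ mulN1r. Qed.

Lemma lformE x : l x = \sum_(j < n) x 0 j * l (delta_mx 0 j).
Proof.
rewrite {1}(row_sum_delta x).
elim/big_rec2: _ => [|j y1 y2 _ <-]; first exact: lform0.
by rewrite ll.
Qed.

Lemma lform_continuous : continuous l.
Proof.
move=> x; rewrite (_ : l = (fun x => \sum_(j < n) x 0 j * l (delta_mx 0 j))).
  apply: (@cvg_big _ _ _ _ _ (@add_continuous R^o) _ (nbhs x)) => j _.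
  by apply: cvgM; [exact: coord_continuous|exact: cvg_cst].
by apply/funext => y; exact: lformE.
Qed.

Lemma lform_is_derive (F : R * R -> 'rV[R]_n) (z e : R * R) (d : 'rV[R]_n) :
  is_derive z e F d -> is_derive z e (fun w => l (F w)) (l d).
Proof.
move=> [dF <-].
have E : (fun h : R => h^-1 *: (l (F (h *: e + z)) - l (F z))) =
    (fun h : R => l (h^-1 *: (F (h *: e + z) - F z))).
  by apply/funext => h; rewrite lformZ lformD lformN.
have cv : (fun h : R => h^-1 *: (l (F (h *: e + z)) - l (F z))) @ 0^' --> l
  ('D_e F z).
  rewrite E; apply: (@cvg_comp _ _ _ (fun h : R => h^-1 *: (F (h *: e + z) - F
    z)) l _ (nbhs ('D_e F z))).
    exact: dF.
  exact: lform_continuous.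
split; first by apply/cvg_ex; exists (l ('D_e F z)).
exact/cvg_lim.
Qed.

End lform.

Definition vC1_at (R : realType) (n : nat) (F d1 d2 : R * R -> 'rV[R]_n) (z : R
  * R) : Prop :=
  [/\ is_derive z (1, 0) F (d1 z), is_derive z (0, 1) F (d2 z),
     {for z, continuous d1} & {for z, continuous d2}].

Lemma C1_at_lform (R : realType) (n : nat) (l : 'rV[R]_n -> R)
    (F d1 d2 : R * R -> 'rV[R]_n) (z : R * R) : lform l -> vC1_at F d1 d2 z ->
  C1_at (fun w => l (F w)) (fun w => l (d1 w)) (fun w => l (d2 w)) z.
Proof.
move=> ll [h1 h2 c1 c2]; split; [exact: lform_is_derive|exact: lform_is_derive|
  |].
- by apply: (continuous_comp c1); exact: lform_continuous.
- by apply: (continuous_comp c2); exact: lform_continuous.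
Qed.

Lemma C1_atD (R : realType) (u d1 d2 u' d1' d2' : R * R -> R) (z : R * R) :
  C1_at u d1 d2 z -> C1_at u' d1' d2' z ->
  C1_at (fun w => u w + u' w) (fun w => d1 w + d1' w) (fun w => d2 w + d2' w) z.
Proof.
move=> [h1 h2 c1 c2] [h1' h2' c1' c2']; split.
- by apply: is_deriveD.
- by apply: is_deriveD.
- exact: cvgD.
- exact: cvgD.
Qed.

(** Equality at z alone is enough because the continuity of [d2'] is supplied separately. *)
Lemma C1_at_eq (R : realType) (u d1 d2 d2' : R * R -> R) (z : R * R) :
  C1_at u d1 d2 z -> d2 z = d2' z -> {for z, continuous d2'} -> C1_at u d1 d2'
    z.
Proof. by move=> [h1 h2 c1 c2] E c2'; split => //; rewrite -E. Qed.

(* The i-th coordinate of F1 + T F2, paired with minus that of its image under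
   T, satisfies the Cauchy-Riemann equations, because T plays the role of
   multiplication by the imaginary unit. *)
Lemma slice_identity (R : realType) (n : nat) (T : 'rV[R]_n -> 'rV[R]_n)
    (F1 F2 A1 B1 A2 B2 : R * R -> 'rV[R]_n) (E : set (R * R)) :
  (forall (a : R) x y, T (a *: x + y) = a *: T x + T y) ->
  (forall x, T (T x) = - x) ->
  open E -> connected E ->
  (forall z, E z -> [/\ vC1_at F1 A1 B1 z, vC1_at F2 A2 B2 z,
                        A1 z = B2 z & A2 z = - B1 z]) ->
  (forall z, E z -> F1 z + T (F2 z) = 0) \/
  (forall p, E p -> \forall z \near p, z != p -> F1 z + T (F2 z) <> 0).
Proof.
move=> linT TT oE cE HE.
pose l (i : 'I_n) (x : 'rV[R]_n) : R := x 0 i.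
have ll i : lform (l i) by move=> a x y; rewrite /l !mxE.
have lT i : lform (fun x => l i (T x)) by move=> a x y; rewrite linT ll.
have lNT i : lform (fun x => - l i (T x)).
  by move=> a x y; rewrite linT ll opprD mulrN.
have T0 : T 0 = 0.
  by have := linT (-1) 0 0; rewrite scaler0 addr0 scaleN1r addNr.
have TN x : T (- x) = - T x.
  by have := linT (-1) x 0; rewrite addr0 T0 addr0 !scaleN1r.
(* The alternative is settled for the vector function first. At a point p where its zeros are not
   isolated, no coordinate pair has isolated zeros either, so every pair vanishes on E. *)
have [|] := pselect (forall p, E p -> \forall z \near p, z != p -> F1 z + T (F2
  z) <> 0).
  by right.
move=> /existsNP[p /not_implyP[Ep pN]]; left => z Ez.
apply/rowP => i; rewrite [RHS]mxE.
pose u w := l i (F1 w) + l i (T (F2 w)).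
pose v w := - l i (T (F1 w)) + l i (F2 w).
pose ux w := l i (A1 w) + l i (T (A2 w)).
pose vx w := - l i (T (A1 w)) + l i (A2 w).
have [|uv0|iso] := @CR_identity R u v ux vx E oE cE.
- move=> w Ew; have [h1 h2 e1 e2] := HE w Ew.
  have Cu := C1_atD (C1_at_lform (ll i) h1) (C1_at_lform (lT i) h2).
  have Cv := C1_atD (C1_at_lform (lNT i) h1) (C1_at_lform (ll i) h2).
  have [_ _ cux _] := Cu; have [_ _ cvx _] := Cv.
  split.
    apply: (C1_at_eq Cu); last by apply: cvgN; exact: cvx.
    by rewrite /vx e1 e2 (lformN (ll i)) opprD !opprK addrC.
  apply: (C1_at_eq Cv) => //.
  by rewrite /ux e1 e2 TN (lformN (ll i)) addrC.
- have [uz _] := uv0 z Ez; move: uz; rewrite /u => uz.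
  by rewrite mxE.
- exfalso; apply: pN; apply: filterS (iso p Ep) => w wiso wp Fw.
  apply: (wiso wp); split; first by rewrite /u -(lformD (ll i)) Fw (lform0 (ll
    i)).
  have : T (F1 w + T (F2 w)) = 0 by rewrite Fw T0.
  have := linT 1 (F1 w) (T (F2 w)); rewrite !scale1r => ->; rewrite TT => TF.
  by rewrite /v (subr0_eq TF) addNr.
Qed.

(** * The algebra: multiplication, imaginary units and the slices C_J *)

Section slices.
Context {R : realType} {n : nat} (Alg : altstar_alg R n).
Local Notation A := 'rV[R]_n.
Local Notation "x ** y" := (amul Alg x y) (at level 40, left associativity).
Local Notation e := (aone Alg).
Local Notation cj := (acj Alg).

Lemma amulDl x y z : (x + y) ** z = x ** z + y ** z.
Proof. by have := mul_linl Alg 1 x y z; rewrite !scale1r. Qed.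

Lemma amulDr x y z : z ** (x + y) = z ** x + z ** y.
Proof. by have := mul_linr Alg 1 x y z; rewrite !scale1r. Qed.

Lemma amul0l z : 0 ** z = 0.
Proof. by have := mul_linl Alg (-1) 0 0 z; rewrite scaler0 addr0 scaleN1r
  addNr. Qed.

Lemma amul0r z : z ** 0 = 0.
Proof. by have := mul_linr Alg (-1) 0 0 z; rewrite scaler0 addr0 scaleN1r
  addNr. Qed.

Lemma amulZl (a : R) x z : (a *: x) ** z = a *: (x ** z).
Proof. by have := mul_linl Alg a x 0 z; rewrite !addr0 amul0l addr0. Qed.

Lemma amulZr (a : R) x z : z ** (a *: x) = a *: (z ** x).
Proof. by have := mul_linr Alg a x 0 z; rewrite !addr0 amul0r addr0. Qed.

Lemma amulNl x z : (- x) ** z = - (x ** z).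
Proof. by rewrite -scaleN1r amulZl scaleN1r. Qed.

Lemma amulNr x z : z ** (- x) = - (z ** x).
Proof. by rewrite -scaleN1r amulZr scaleN1r. Qed.

Lemma amulBl x y z : (x - y) ** z = x ** z - y ** z.
Proof. by rewrite amulDl amulNl. Qed.

Lemma cj0 : cj 0 = 0.
Proof. by have := cj_lin Alg (-1) 0 0; rewrite scaler0 addr0 scaleN1r addNr.
  Qed.

Lemma cjD x y : cj (x + y) = cj x + cj y.
Proof. by have := cj_lin Alg 1 x y; rewrite !scale1r. Qed.

Lemma cjZ (a : R) x : cj (a *: x) = a *: cj x.
Proof. by have := cj_lin Alg a x 0; rewrite !addr0 cj0 addr0. Qed.

Lemma cj1 : cj e = e.
Proof. by have := cj_real Alg 1; rewrite scale1r. Qed.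

Lemma cj_sph J : sphA Alg J -> cj J = - J.
Proof. by case => /eqP; rewrite /trA addrC addr_eq0 => /eqP. Qed.

Lemma sqr_sph J : sphA Alg J -> J ** J = - e.
Proof. by move=> SJ; have [_] := SJ; rewrite /nrA cj_sph// amulNr => <-;
  rewrite opprK. Qed.

Lemma amul_sphK J x : sphA Alg J -> J ** (J ** x) = - x.
Proof.
move=> SJ; have /eqP := assoc_alt12 Alg J x.
by rewrite subr_eq0 sqr_sph// amulNl mul1x => /eqP.
Qed.

Lemma sphN J : sphA Alg J -> sphA Alg (- J).
Proof.
move=> SJ; have cjN : cj (- J) = J by rewrite -scaleN1r cjZ cj_sph// scaleN1r
  opprK.
by split; rewrite /trA /nrA cjN ?addNr// amulNl sqr_sph// opprK.
Qed.

Lemma ee_gt0 : 0 < (e *m e^T) 0 0.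
Proof.
rewrite mxE; under eq_bigr do rewrite mxE.
rewrite lt_neqAle sumr_ge0 ?andbT; last by move=> i _; rewrite -expr2 sqr_ge0.
rewrite eq_sym; apply: contra (one_neq0 Alg) => /eqP s0; apply/eqP/rowP => i.
rewrite [RHS]mxE; apply/eqP; rewrite -sqrf_eq0 expr2; apply/eqP.
apply: (psumr_eq0P (P := xpredT) (F := fun i => e 0 i * e 0 i) _ s0) => // j _.
by rewrite -expr2 sqr_ge0.
Qed.

Lemma lform_realcoef : lform (realcoef Alg).
Proof.
by move=> a x y; rewrite /realcoef mulmxDl -scalemxAl !mxE mulrDl mulrA.
Qed.

Lemma realcoefZ1 (a : R) : realcoef Alg (a *: e) = a.
Proof. by rewrite (lformZ lform_realcoef) /realcoef mulfV ?mulr1// gt_eqF//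
  ee_gt0. Qed.

Definition slpt (J : A) (z : R * R) : A := z.1 *: e + z.2 *: J.

Lemma cj_slpt J z : sphA Alg J -> cj (slpt J z) = slpt J (z.1, - z.2).
Proof. by move=> SJ; rewrite /slpt cjD !cjZ cj1 cj_sph// scalerN scaleNr. Qed.

Lemma trA_slpt J z : sphA Alg J -> trA Alg (slpt J z) = (2 * z.1) *: e.
Proof.
by move=> SJ; rewrite /trA cj_slpt// /slpt/= scaleNr addrACA subrr addr0
  -scalerDl mulr_natl.
Qed.

(** Half the trace recovers alpha from alpha + beta J, and beta is minus the real part of J (alpha +
    beta J) = - beta + alpha J. Both forms are linear on the whole algebra, so [slcoord J] is a
    continuous left inverse of [slpt J]. *)
Definition coordRe (x : A) : R := 2^-1 * realcoef Alg (trA Alg x).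
Definition coordIm (J x : A) : R := - coordRe (J ** x).

Lemma lform_coordRe : lform coordRe.
Proof.
move=> a x y; rewrite /coordRe /trA cjD cjZ addrACA -scalerDr lform_realcoef.
by ring.
Qed.

Lemma lform_coordIm J : lform (coordIm J).
Proof.
by move=> a x y; rewrite /coordIm mul_linr lform_coordRe opprD mulrN.
Qed.

Lemma coordRe_slpt J z : sphA Alg J -> coordRe (slpt J z) = z.1.
Proof. by move=> SJ; rewrite /coordRe trA_slpt// realcoefZ1 mulKf. Qed.

Lemma coordIm_slpt J z : sphA Alg J -> coordIm J (slpt J z) = z.2.
Proof.
move=> SJ; rewrite /coordIm (_ : J ** _ = slpt J (- z.2, z.1)).
  by rewrite coordRe_slpt// opprK.
by rewrite /slpt amulDr !amulZr mulx1 sqr_sph// scalerN scaleNr addrC.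
Qed.

Definition slcoord (J x : A) : R * R := (coordRe x, coordIm J x).

Lemma slptK J : sphA Alg J -> cancel (slpt J) (slcoord J).
Proof.
by move=> SJ z; rewrite /slcoord coordRe_slpt// coordIm_slpt//
  -surjective_pairing.
Qed.

Lemma slcoord_continuous J : continuous (slcoord J).
Proof.
move=> x; have cRe := lform_continuous lform_coordRe (x := x).
have cIm := lform_continuous (lform_coordIm J) (x := x).
exact: (cvg_pair cRe cIm).
Qed.

Lemma slpt_continuous J : continuous (slpt J).
Proof.
move=> z; apply: cvgD.
  by apply: cvgZr_tmp; exact: cvg_fst.
by apply: cvgZr_tmp; exact: cvg_snd.
Qed.

(** Traces give the first coordinates, squares of the imaginary parts the second ones up to sign.
    The sign is genuine: (beta, J) and (-beta, -J) give the same point. *)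
Lemma slpt_eq J J' z z' : sphA Alg J -> sphA Alg J' -> slpt J z = slpt J' z' ->
  z.1 = z'.1 /\ (z.2 = z'.2 \/ z.2 = - z'.2).
Proof.
move=> SJ SJ' E; have E1 : z.1 = z'.1.
  by rewrite -(coordRe_slpt z SJ) E coordRe_slpt.
split => //.
have E2 : z.2 *: J = z'.2 *: J' by move: E; rewrite /slpt E1 => /addrI.
have : (z.2 *: J) ** (z.2 *: J) = (z'.2 *: J') ** (z'.2 *: J') by rewrite E2.
rewrite !(amulZl, amulZr) !sqr_sph// !scalerA !scalerN => /oppr_inj.
move=> /(congr1 (realcoef Alg)); rewrite !realcoefZ1 -!expr2 => /eqP.
by rewrite eqf_sqr => /orP[] /eqP; [left|right].
Qed.

(** Neighbourhoods in the plane are pulled back along [slcoord J]. Isolation is assumed at every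
    point of E, in Z or not: outside Z it gives closedness, on Z discreteness. *)
Lemma closed_discrete_slpt J (E Z : set (R * R)) : sphA Alg J -> Z `<=` E ->
  (forall p, E p -> \forall z \near p, z != p -> ~ Z z) ->
  closed_discrete_in (slpt J @` Z) (slpt J @` E).
Proof.
move=> SJ ZE iso; split.
  exists (closure (slpt J @` Z)); split; first exact: closed_closure.
  rewrite eqEsubset; split => x.
    by move=> Zx; split; [apply: image_subset Zx|exact: subset_closure].
  move=> [[z Ez <-] clx].
  have [|_ [[w Zw <-] /=]] := clx (slcoord J @^-1` [set w | w != z -> ~ Z w]).
    by apply: slcoord_continuous; rewrite slptK//; exact: iso.
  rewrite slptK// => zw; have [<-|/zw//] := eqVneq w z.
  by exists w.
move=> _ [z Zz <-].
have nz : \forall q \near slpt J z, slcoord J q != z -> ~ Z (slcoord J q).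
  have nZ : nbhs (slcoord J (slpt J z)) [set w | w != z -> ~ Z w].
    by rewrite slptK//; exact: iso (ZE _ Zz).
  exact: (slcoord_continuous nZ).
apply: filterS nz => _ /[swap] -[w Zw <-]; rewrite slptK// => zw.
by have [->//|/zw] := eqVneq w z.
Qed.

(** S contains the image of a non-empty open set, so it has a non-isolated point; discreteness fails
    whatever U is. *)
Lemma closed_discrete_slpt_open J (E : set (R * R)) (S U : set A) : sphA Alg J
  ->
  open E -> E !=set0 -> slpt J @` E `<=` S -> ~ closed_discrete_in S U.
Proof.
move=> SJ oE [p Ep] ES [_ /(_ (slpt J p) (ES _ (ex_intro2 _ _ p Ep erefl))) nU].
have : \forall z \near p, z = p.
  have nE : \forall z \near p, E z by exact: open_nbhs_nbhs.
  have : \forall z \near p, S (slpt J z) -> slpt J z = slpt J p.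
    exact: (slpt_continuous nU).
  apply: filterS2 nE => z Ez /(_ (ES _ (ex_intro2 _ _ z Ez erefl))).
  exact: (can_inj (slptK SJ)).
move=> /nbhs_ballP[r /= r0 Br].
have /Br/(congr1 fst)/= : ball p r (p.1 + r / 2, p.2).
  split; last exact: ballxx.
  by rewrite /ball/= opprD addNKr normrN gtr0_norm ?divr_gt0// ltr_pdivrMr//
    ltr_pMr// ltr1n.
by move=> /eqP; rewrite -subr_eq0 addrC addKr gt_eqF// divr_gt0.
Qed.

End slices.

(** * The two halves of a product domain *)

(** As C avoids the real axis, its points with z.2 > 0 are also those with z.2 >= 0: a subset both
    open and closed in C. *)
Lemma connected_upper (R : realType) (C : set (R * R)) (p : R * R) : connected
  C ->
  (forall z, C z -> z.2 != 0) -> C p -> 0 < p.2 -> forall z, C z -> 0 < z.2.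
Proof.
move=> cC C0 Cp p0.
have csnd : continuous (snd : R * R -> R) by move=> z; exact: cvg_snd.
have <- : C `&` [set z | 0 < z.2] = C; last by move=> z [].
apply: cC.
- by exists p.
- exists [set z : R * R | 0 < z.2] => //.
  by apply: (@open_comp _ _ snd [set x : R | 0 < x]) => //; exact: open_gt.
- exists [set z : R * R | 0 <= z.2].
    by apply: (@closed_comp _ _ snd [set x : R | 0 <= x]) => //; exact:
      closed_ge.
  rewrite eqEsubset; split => z [Cz z0]; split => //=; first exact: ltW.
  by rewrite lt_neqAle eq_sym C0.
Qed.

(** Each component lies in a single open half-plane and conjugation exchanges them, so they are the
    upper and lower halves of D. *)
Lemma product_domain_halves (R : realType) (D : set (R * R)) : product_domain D
  ->
  connected (D `&` [set z | 0 < z.2]) /\ connected (D `&` [set z | z.2 < 0]).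
Proof.
move=> [D0 [z1 [z2 [Dz1 Dz2 _ cover conjE]]]].
have D0' z : D z -> z.2 != 0.
  by move=> Dz; apply/eqP => z0; apply: (D0 z.1); rewrite -z0
    -surjective_pairing.
set C1 := connected_component D z1 in cover conjE.
set C2 := connected_component D z2 in cover conjE.
have C1D : C1 `<=` D := connected_component_sub (x := z1).
have C2D : C2 `<=` D := connected_component_sub (x := z2).
have cC1 : connected C1 := component_connected (x := z1).
have cC2 : connected C2 := component_connected (x := z2).
have C1z1 : C1 z1 := connected_component_refl Dz1.
have C2z2 : C2 z2 := connected_component_refl Dz2.
have DC z : D z -> C1 z \/ C2 z.
  move=> Dz; have Cz : connected_component D z z := connected_component_refl Dz.
  by have [<-|<-] := cover z Dz; [left|right].
have conjC z : C1 z -> C2 (z.1, - z.2) by move=> Cz; rewrite -conjE; exists z.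
have conjC' z : C2 z -> C1 (z.1, - z.2).
  by rewrite -conjE => -[w Cw <-]/=; rewrite opprK -surjective_pairing.
have up (C C' : set (R * R)) p : C `<=` D -> C' `<=` D -> connected C -> C p ->
  0 < p.2 ->
    (forall z, C' z -> C (z.1, - z.2)) -> (forall z, D z -> C z \/ C' z) ->
    D `&` [set z | 0 < z.2] = C /\ D `&` [set z | z.2 < 0] = C'.
  move=> CD C'D cC Cp p0 conjCC' DCC'.
  have Cpos z : C z -> 0 < z.2.
    by apply: (connected_upper cC _ Cp p0) => w /CD; exact: D0'.
  have C'neg z : C' z -> z.2 < 0 by move=> /conjCC'/Cpos; rewrite oppr_gt0.
  split; rewrite eqEsubset; split => z.
  - by move=> [/DCC'[//|/C'neg z0] /=]; rewrite ltNge (ltW z0).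
  - by move=> Cz; split; [exact: CD|exact: Cpos].
  - by move=> [/DCC'[/Cpos z0|//] /=]; rewrite ltNge (ltW z0).
  - by move=> Cz; split; [exact: C'D|exact: C'neg].
have [z1n|z1p|/eqP] := ltgtP z1.2 0.
(* If z1 lies below the axis, the components swap roles, with the conjugate of z1 as base point in
   C2. *)
- have [||-> ->] := up C2 C1 (z1.1, - z1.2) C2D C1D cC2 (conjC _ C1z1) _ conjC
  _; rewrite ?oppr_gt0//.
  by move=> z /DC[]; [right|left].
- by have [-> ->] := up C1 C2 z1 C1D C2D cC1 C1z1 z1p conjC' DC.
- by rewrite (negPf (D0' _ Dz1)).
Qed.

(** * Slice regular functions restricted to slices *)

Section slice_functions.
Context {R : realType} {n : nat} (Alg : altstar_alg R n).
Local Notation A := 'rV[R]_n.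
Local Notation "x ** y" := (amul Alg x y) (at level 40, left associativity).
Local Notation e := (aone Alg).
Local Notation slpt := (slpt Alg).
Local Notation sph := (sphA Alg).

Variables (D : set (R * R)) (f : A -> A) (F1 F2 : R * R -> A).
Hypothesis D_open : open D.
Hypothesis D_conj : forall a b : R, D (a, b) -> D (a, - b).
Hypothesis F_conj : forall a b, D (a, b) -> F1 (a, - b) = F1 (a, b) /\ F2 (a, -
  b) = - F2 (a, b).
Hypothesis F1_C1 : C1_on D F1.
Hypothesis F2_C1 : C1_on D F2.
Hypothesis F_CR : forall z, D z ->
  dalpha F1 z - dbeta F2 z = 0 /\ dalpha F2 z + dbeta F1 z = 0.
Hypothesis fE : forall z J, D z -> sph J -> f (z.1 *: e + z.2 *: J) = F1 z + J
  ** F2 z.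

Local Notation Omega := (OmegaD Alg D).
Local Notation V := (zeroset Alg D f).
Local Notation FJ J z := (F1 z + J ** F2 z).

Lemma f_slpt J z : D z -> sph J -> f (slpt J z) = FJ J z.
Proof. by move=> Dz SJ; exact: fE. Qed.

Lemma Omega_slpt J z : D z -> sph J -> Omega (slpt J z).
Proof. by move=> Dz SJ; exists z, J. Qed.

(** The point may come from another unit and the opposite beta; invariance of D under conjugation
    absorbs the sign. *)
Lemma Omega_slptP J z : sph J -> Omega (slpt J z) -> D z.
Proof.
move=> SJ [z' [J' [Dz' [SJ' E]]]].
have [E1 E2] := slpt_eq SJ SJ' E; rewrite (surjective_pairing z) E1.
by rewrite (surjective_pairing z') in Dz'; case: E2 => ->//; exact: D_conj.
Qed.

Lemma sliceCE J : sliceC Alg J = slpt J @` setT.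
Proof.
rewrite eqEsubset; split => x; first by move=> [a [b ->]]; exists (a, b).
by move=> [z _ <-]; exists z.1, z.2.
Qed.

Lemma sliceCpE J : sliceCp Alg J = slpt J @` [set z | 0 < z.2].
Proof.
rewrite eqEsubset; split => x; first by move=> [a [b [b0 ->]]]; exists (a, b).
by move=> [z z0 <-]; exists z.1, z.2.
Qed.

(** W will be the whole plane for C_J and the upper half-plane for C_J^+. *)
Lemma Omega_slice J (W : set (R * R)) : sph J ->
  Omega `&` slpt J @` W = slpt J @` (D `&` W).
Proof.
move=> SJ; rewrite eqEsubset; split => x.
  by move=> [+ [z Wz xE]]; rewrite -xE => /(Omega_slptP SJ) Dz; exists z.
by move=> [z [Dz Wz] <-]; split; [exact: Omega_slpt|exists z].
Qed.

Lemma zeroset_slice J (W : set (R * R)) : sph J ->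
  V `&` slpt J @` W = slpt J @` [set z | (D `&` W) z /\ FJ J z = 0].
Proof.
move=> SJ; rewrite eqEsubset; split => x.
  move=> [[+ +] [z Wz xE]]; rewrite -xE => /(Omega_slptP SJ) Dz.
  by rewrite f_slpt// => Fz; exists z.
move=> [z [[Dz Wz] Fz] <-]; split; last by exists z.
by split; [exact: Omega_slpt|rewrite f_slpt].
Qed.

Lemma closed_discrete_slice J (W : set (R * R)) : sph J ->
  (forall p, (D `&` W) p -> \forall z \near p, z != p -> FJ J z <> 0) ->
  closed_discrete_in (V `&` slpt J @` W) (Omega `&` slpt J @` W).
Proof.
move=> SJ iso; rewrite Omega_slice// zeroset_slice//.
apply: closed_discrete_slpt => //; first by move=> z [].
by move=> p /iso; apply: filterS => z Fz zp [_]; exact: Fz.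
Qed.

Lemma not_closed_discrete_slice J (W E : set (R * R)) (U : set A) : sph J ->
  open E -> E !=set0 -> E `<=` D `&` W -> (forall z, E z -> FJ J z = 0) ->
  ~ closed_discrete_in (V `&` slpt J @` W) U.
Proof.
move=> SJ oE E0 EDW FE; rewrite zeroset_slice//.
apply: (closed_discrete_slpt_open SJ oE E0) => x [z Ez <-].
by exists z => //; split; [exact: EDW|exact: FE].
Qed.

Lemma FJ_identity J (E : set (R * R)) : sph J -> open E -> E `<=` D ->
  connected E ->
  (forall z, E z -> FJ J z = 0) \/
  (forall p, E p -> \forall z \near p, z != p -> FJ J z <> 0).
Proof.
move=> SJ oE ED cE.
apply: (@slice_identity R n (amul Alg J) F1 F2 (dalpha F1) (dbeta F1) (dalpha
  F2) (dbeta F2) _ _ _ oE cE).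
- by move=> a x y; exact: mul_linr.
- by move=> x; exact: amul_sphK.
- move=> z /ED Dz; have [/eqP + /eqP] := F_CR Dz.
  rewrite subr_eq0 addr_eq0 => /eqP ab /eqP ba.
  have [d1 d2 c1 c2] := F1_C1 Dz; have [d1' d2' c1' c2'] := F2_C1 Dz.
  split; [| |exact: ab|exact: ba].
  + by split; [exact: derivableP|exact: derivableP|exact: c1|exact: c2].
  + by split; [exact: derivableP|exact: derivableP|exact: c1'|exact: c2'].
Qed.

Lemma FJ_opp J z : D z -> FJ (- J) z = FJ J (z.1, - z.2).
Proof.
rewrite {1 2 3}(surjective_pairing z) => Dz; have [-> ->] := F_conj Dz.
by rewrite amulNl amulNr.
Qed.

Lemma FJ_both J z : sph J -> FJ J z = 0 -> FJ (- J) z = 0 -> F1 z = 0 /\ F2 z =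
  0.
Proof.
move=> SJ; rewrite amulNl => E1 E2.
have F10 : F1 z = 0.
  have : F1 z + F1 z = 0 by rewrite -[RHS](addr0 0) -{1}E1 -E2 addrACA subrr
    addr0.
  by move/eqP; rewrite -mulr2n -scaler_nat scaler_eq0 pnatr_eq0 => /eqP.
split => //; move: E1; rewrite F10 add0r => E1.
by have := amul_sphK (F2 z) SJ; rewrite E1 amul0r => /eqP; rewrite eq_sym
  oppr_eq0 => /eqP.
Qed.

Lemma F0_f0 : (forall z, D z -> F1 z = 0 /\ F2 z = 0) -> forall x, Omega x -> f
  x = 0.
Proof.
move=> F0 x [z [J [Dz [SJ ->]]]]; rewrite fE//.
by have [-> ->] := F0 z Dz; rewrite amul0r addr0.
Qed.

(** Here im(x) = beta J has inverse - J / beta and f(x) - f(x^c) = 2 J F2, so the product collapses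
    by J (J F2) = - F2. The value does not depend on J. *)
Lemma sderA_slpt J z : sph J -> D z -> z.2 != 0 ->
  sderA Alg f (slpt J z) = z.2^-1 *: F2 z.
Proof.
move=> SJ Dz z0; rewrite /sderA cj_slpt// /imA trA_slpt//.
have Dz' : D (z.1, - z.2) by rewrite (surjective_pairing z) in Dz; exact:
  D_conj.
rewrite !f_slpt// -FJ_opp//.
have -> : slpt J z - 2^-1 *: ((2 * z.1) *: e) = z.2 *: J.
  by rewrite scalerA mulKf// /slpt addrAC subrr add0r.
rewrite /invA /nrA !cjZ cj_sph// amulZl amulZr amulNr sqr_sph// opprK.
rewrite scalerA realcoefZ1 amulNl.
have -> : FJ J z - (F1 z - J ** F2 z) = 2 *: (J ** F2 z).
  by rewrite opprB addrC addrA addrNK scaler_nat mulr2n.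
rewrite amulZr !(amulZl, amulNl, amulNr) amul_sphK//.
rewrite !scalerN opprK !scalerA; congr (_ *: _).
by field.
Qed.

Lemma realA_slpt J z : sph J -> realA Alg (slpt J z) <-> z.2 = 0.
Proof.
move=> SJ; split.
  move=> [r _ E]; rewrite -(coordIm_slpt z SJ) -E.
  by rewrite -[r *: e]addr0 -(scale0r J) -[_ + _]/(slpt J (r, 0)) coordIm_slpt.
by move=> z0; exists z.1 => //; rewrite /slpt z0 scale0r addr0.
Qed.

End slice_functions.

(** * The dichotomy on slice domains and the trichotomy on product domains *)

Theorem theorem4p11 (R : realType) (n : nat) (Alg : altstar_alg R n)
  (HS : exists J, sphA Alg J)
  (D : set (R * R)) (HDopen : open D) (HDne : D !=set0)
  (HDconj : forall a b : R, D (a, b) -> D (a, - b))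
  (f : 'rV[R]_n -> 'rV[R]_n) (Hf : slice_regular Alg D f) :
  let Omega := OmegaD Alg D in
  let V := zeroset Alg D f in
  let P1 := forall J, sphA Alg J ->
      closed_discrete_in (V `&` sliceC Alg J) (Omega `&` sliceC Alg J) in
  let P2 := forall x, Omega x -> f x = 0 in
  let star := fun J : 'rV[R]_n =>
      (forall x, (Omega `&` sliceCp Alg J) x -> f x = 0) /\
      closed_discrete_in (V `&` sliceCp Alg (- J)) (Omega `&` sliceCp Alg (- J)) in
  let P3 := exists2 J0, sphA Alg J0 & star J0 in
  (slice_domain D -> exactly_one2 P1 P2) /\
  (product_domain D ->
     exactly_one3 P1 P2 P3 /\
     forall J0, sphA Alg J0 -> star J0 ->
       [/\ [set J | sphA Alg J /\ star J] =
           [set J | sphA Alg J /\ forall x, Omega x -> ~ realA Alg x ->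
                      amul Alg (J - J0) (sderA Alg f x) = 0],
           ((exists x, [/\ Omega x, ~ realA Alg x, sderA Alg f x != 0 &
                          ~ right_zero_divisor Alg (sderA Alg f x)]) ->
              [set J | sphA Alg J /\ star J] = [set J0]) &
           (forall K, sphA Alg K -> ~ star K ->
              closed_discrete_in (V `&` sliceCp Alg K) (Omega `&` sliceCp Alg K))]).
Proof.
move=> Omega V P1 P2 star P3.
have [F1 [F2 [Fconj C1 C2 FCR fE]]] := Hf.
pose FJ J z := F1 z + amul Alg J (F2 z).
have fP2 : (forall z, D z -> F1 z = 0 /\ F2 z = 0) -> P2 by exact: F0_f0 fE.
have P2F J z : P2 -> sphA Alg J -> D z -> FJ J z = 0.
  by move=> p2 SJ Dz; rewrite /FJ -(f_slpt fE Dz SJ); exact/p2/Omega_slpt.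
split.
  move=> [Dconn _]; split.
    have [|] := pselect P1; first by left.
    move=> /existsNP[J /not_implyP[SJ ncd]]; right; apply: fP2 => z Dz.
    (* D is connected and invariant under conjugation, so if F1 + J F2 vanishes on D then so does F1
       - J F2. *)
    have [FJ0|iso] := FJ_identity C1 C2 FCR SJ HDopen (@subset_refl _ D) Dconn.
      have Dz' : D (z.1, - z.2) by rewrite (surjective_pairing z) in Dz; exact:
        HDconj.
      by apply: (FJ_both SJ); [exact: FJ0|rewrite (FJ_opp Alg Fconj)//; exact:
        FJ0].
    exfalso; apply: ncd; rewrite sliceCE; apply: (closed_discrete_slice HDconj
      fE) => //.
    by move=> p [Dp _]; exact: iso.
  move=> [p1 p2]; have [J SJ] := HS; have := p1 J SJ; rewrite sliceCE.
  apply: (not_closed_discrete_slice HDconj fE SJ HDopen HDne) => //.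
  by move=> z Dz; exact: P2F.
move=> Dprod; have [D0 _] := Dprod; have [cDp cDm] := product_domain_halves
  Dprod.
set Dp := D `&` [set z | 0 < z.2] in cDp; set Dm := D `&` [set z | z.2 < 0] in
  cDm.
have csnd : continuous (snd : R * R -> R) by move=> z; exact: cvg_snd.
have oDp : open Dp.
  apply: openI => //.
  by apply: (@open_comp _ _ snd [set x : R | 0 < x]) => //; exact: open_gt.
have oDm : open Dm.
  apply: openI => //.
  by apply: (@open_comp _ _ snd [set x : R | x < 0]) => //; exact: open_lt.
have D0' z : D z -> z.2 != 0.
  by move=> Dz; apply/eqP => z0; apply: (D0 z.1); rewrite -z0
    -surjective_pairing.
have Dconj z : D z -> D (z.1, - z.2).
  by rewrite {1}(surjective_pairing z) => Dz; exact: HDconj.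
have DpVDm z : D z -> Dp z \/ Dm z.
  by move=> Dz; have := D0' z Dz; rewrite neq_lt => /orP[]; [right|left].
have DmDp z : Dm z -> Dp (z.1, - z.2).
  by move=> [Dz /= z0]; split; [exact: Dconj|rewrite /= oppr_gt0].
have Dp0 : Dp !=set0.
  by have [z /DpVDm[Dz|/DmDp Dz]] := HDne; [exists z|exists (z.1, - z.2)].
(* [Zp K] means that f vanishes on the half-slice of K. Everything reduces to it: closed
   discreteness there is its negation, [star K] is [Zp K] without [Zp (- K)], and both together
   force f = 0. *)
pose Zp K := forall z, Dp z -> FJ K z = 0.
have cdp K : sphA Alg K ->
    closed_discrete_in (V `&` sliceCp Alg K) (Omega `&` sliceCp Alg K) <-> ~ Zp
      K.
  move=> SK; rewrite sliceCpE; split.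
    by move=> cd ZK; apply: (not_closed_discrete_slice HDconj fE SK oDp Dp0 _
      ZK cd).
  move=> NZ; apply: (closed_discrete_slice HDconj fE) => //.
  by have [//|] := FJ_identity C1 C2 FCR SK oDp (@subIsetl _ _ _) cDp.
have starE K : sphA Alg K -> star K <-> Zp K /\ ~ Zp (- K).
  move=> SK; rewrite /star (cdp _ (sphN SK)) sliceCpE (Omega_slice HDconj)//.
  split=> -[h1 h2]; split => //.
    by move=> z [Dz z0]; rewrite /FJ -(f_slpt fE Dz SK); apply: h1; exists z.
  by move=> _ [z [Dz z0] <-]; rewrite (f_slpt fE Dz SK); exact: h1.
(* The stem functions vanish on the upper half by [FJ_both], on the lower half by their parity under
   conjugation. *)
have ZpP2 K : sphA Alg K -> Zp K -> Zp (- K) -> P2.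
  move=> SK Z1 Z2; apply: fP2 => z /DpVDm[Dz|Dz].
    by apply: (FJ_both SK); [exact: Z1|exact: Z2].
  have [Dz' _] := DmDp _ Dz.
  have [E1 E2] := FJ_both SK (Z1 _ (DmDp _ Dz)) (Z2 _ (DmDp _ Dz)).
  have [+ +] := Fconj _ _ Dz'; rewrite opprK -surjective_pairing E1 E2.
  by rewrite oppr0.
have P2Zp K : sphA Alg K -> P2 -> Zp K by move=> SK p2 z [Dz _]; exact: P2F.
have P1Zp K : sphA Alg K -> P1 -> ~ Zp K.
  move=> SK p1 ZK; have := p1 K SK; rewrite sliceCE.
  by apply: (not_closed_discrete_slice HDconj fE SK oDp Dp0 _ ZK) => z [].
split.
  split.
    (* Three cases: no [Zp K] at all gives [P1], both [Zp K] and [Zp (- K)] give [P2], [Zp K]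
       without [Zp (- K)] gives [P3] with J0 = K. *)
    have [[K SK ZK]|NZ] := pselect (exists2 K, sphA Alg K & Zp K).
      right; have [ZNK|NZNK] := pselect (Zp (- K)); first by left; exact: (ZpP2
        K).
      by right; exists K => //; apply/starE.
    left => J SJ; rewrite sliceCE; apply: (closed_discrete_slice HDconj fE) =>
      // p [/DpVDm pD _].
    case: pD => [Dpp|Dmp].
      have [ZJ|] := FJ_identity C1 C2 FCR SJ oDp (@subIsetl _ _ _) cDp; last
        exact.
      by exfalso; apply: NZ; exists J.
    (* The lower half of C_J is the half-slice of -J, so vanishing there amounts to [Zp (- J)]. *)
    have [ZJ|] := FJ_identity C1 C2 FCR SJ oDm (@subIsetl _ _ _) cDm; last
      exact.
    exfalso; apply: NZ; exists (- J); first exact: sphN.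
    move=> z [Dz z0]; rewrite /FJ (FJ_opp Alg Fconj)//; apply: ZJ; split; first
      exact: Dconj.
    by rewrite /= oppr_lt0.
  split; first by move=> [p1 p2]; have [J SJ] := HS; exact: (P1Zp J SJ p1 (P2Zp
    J SJ p2)).
  split; first by move=> [p1 [J0 SJ0 /(starE _ SJ0)[ZJ0 _]]]; exact: (P1Zp J0).
  by move=> [p2 [J0 SJ0 /(starE _ SJ0)[_]]]; apply; exact: (P2Zp _ (sphN SJ0)).
move=> J0 SJ0 /(starE _ SJ0)[ZJ0 NZJ0].
have starJ0 : star J0 by apply/starE.
have sder0 J : sphA Alg J -> star J -> forall x, Omega x -> ~ realA Alg x ->
    amul Alg (J - J0) (sderA Alg f x) = 0.
  move=> SJ /(starE _ SJ)[ZJ _] _ [z [K [Dz [SK ->]]]] _.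
  rewrite -/(slpt Alg K z) (sderA_slpt HDconj Fconj fE SK Dz (D0' _ Dz)) amulZr.
  rewrite (_ : amul Alg _ _ = 0) ?scaler0// amulBl.
  (* On the upper half both J F2 and J0 F2 equal - F1; on the lower half the oddness of F2 transfers
     the equality. *)
  suff H w : Dp w -> amul Alg J (F2 w) - amul Alg J0 (F2 w) = 0.
    have [/H//|/DmDp Dz'] := DpVDm z Dz.
    have := H _ Dz'; have [z' _] := Dz'; have [_ +] := Fconj _ _ z'.
    rewrite opprK -surjective_pairing => -> E.
    by rewrite !amulNr -opprD E oppr0.
  move=> Dw; have := ZJ w Dw; have := ZJ0 w Dw; rewrite /FJ.
  by move=> /eqP; rewrite addrC addr_eq0 => /eqP-> /eqP; rewrite addrC addr_eq0
    => /eqP->; rewrite subrr.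
split.
- rewrite eqEsubset; split => J [SJ HJ]; split => //; first exact: sder0.
  (* As f'_s is F2 / beta on every slice, testing the equation on the slice of J0 alone gives J F2 =
     J0 F2 on all of D. *)
  have HF z : D z -> amul Alg J (F2 z) = amul Alg J0 (F2 z).
    move=> Dz; have z0 := D0' z Dz.
    have := HJ (slpt Alg J0 z) (Omega_slpt Dz SJ0).
    rewrite (sderA_slpt HDconj Fconj fE SJ0 Dz z0) amulZr amulBl.
    have nr : ~ realA Alg (slpt Alg J0 z).
      by move=> /(realA_slpt _ SJ0) zE; rewrite zE eqxx in z0.
    move=> /(_ nr)/eqP; rewrite scaler_eq0 invr_eq0 (negPf z0)/= subr_eq0.
    by move/eqP.
  apply/starE => //; split.
    by move=> z Dz; rewrite /FJ HF; [exact: ZJ0|case: Dz].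
  move=> ZNJ; apply: NZJ0 => z Dz; rewrite -(ZNJ z Dz) /FJ !amulNl HF//.
  by case: Dz.
- move=> [x [Ox nrx sx0 nzd]]; rewrite eqEsubset; split => J /=; last by move=>
  ->.
  move=> [SJ starJ]; have := sder0 J SJ starJ x Ox nrx => E.
  (* Otherwise J - J0 is a non-zero left factor annihilating f'_s(x), which makes f'_s(x) a right
     zero divisor. *)
  apply/eqP; rewrite -subr_eq0; apply/negPn/negP => JJ0.
  by apply: nzd; split => //; exists (J - J0).
(* If f vanished on the half-slice of K, then [~ star K] would force [Zp (- K)] too, hence f = 0,
   against [~ Zp (- J0)]. *)
- move=> K SK NstarK; apply/cdp => // ZK; apply: NstarK; apply/starE => //.
  split => // ZNK; apply: NZJ0; apply: P2Zp; first exact: sphN.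
  exact: (ZpP2 K).
Qed.
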